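(* Consider the state-dependent DMC with noncausal CSI at the transmitter described in the context. For every $R_K\geq 0$ and $B\geq 0$, the covert capacity with noncausal CSI satisfies $$C_{\mathrm{nc}}\geq \max\big(I(U;Y)-I(U;S)\big),$$ where the maximum is over conditional PMFs $P_{U|S}$ on a finite set $\mathcal{U}$ with $|\mathcal{U}|\leq \min\{|\mathcal{X}|+|\mathcal{Y}|+|\mathcal{Z}|+|\mathcal{S}|-2,\ |\mathcal{X}|\cdot|\mathcal{S}|+1\}$ and functions $x:\mathcal{U}\times\mathcal{S}\to\mathcal{X}$, evaluated under the joint distribution $P_S(s)P_{U|S}(u|s)\mathbbm{1}\{x=x(u,s)\}P_{Y,Z|S,X}(y,z|s,x)$, subject to $P_Z=Q_0$, $\mathrm{E}[b(X)]\leq B$, and $I(U;Z)-I(U;Y)<R_K$.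
   Context: A state-dependent discrete memoryless channel consists of finite alphabets $\mathcal{X}$ (input), $\mathcal{S}$ (state), $\mathcal{Y}$ (receiver output), $\mathcal{Z}$ (warden output), a state PMF $P_S$, and a channel law $P_{Y,Z|S,X}$. Over $n$ uses, the state sequence $S^n$ is IID $\sim P_S$, and given $(X^n,S^n)$ the pairs $(Y_i,Z_i)$ are conditionally independent with law $P_{Y,Z|S,X}(\cdot,\cdot|S_i,X_i)$. A designated ''no input'' symbol $x_0\in\mathcal{X}$ is fixed, and $Q_0(z)=\sum_{s}P_S(s)P_{Z|S,X}(z|s,x_0)$; $Q_0^{\times n}$ is its $n$-fold product. It is assumed that $\mathrm{supp}(Q_0)=\mathcal{Z}$. A cost function $b:\mathcal{X}\to[0,\infty)$ is given, with $b(x^n)=\frac1n\sum_{i=1}^n b(x_i)$. A secret key $K$ uniform on $[1:2^{nR_K}]$ and a message $M$ uniform on $[1:2^{nR}]$ are mutually independent and independent of $S^n$; $K$ is known to transmitter and receiver, while $S^n$ is known only to the transmitter. With causal CSI, an $(2^{nR},2^{nR_K},n)$ code consists of an encoder producing $X_i$ as a function of $(M,K,S^i)$ (and possibly private randomness of the transmitter independent of $(M,K,S^n)$), $i\in[1:n]$, and a decoder mapping $(Y^n,K)$ to $\hat M$. With noncausal CSI, the encoder produces $X^n$ from $(M,K,S^n)$ (and possibly such private randomness). $P_e^{(n)}=P(\hat M\neq M)$, and $\widehat{P}_{Z^n}$ is the distribution of the warden's output $Z^n$ induced by the code. A rate $R$ is achievable (for given $R_K,B$) if there is a sequence of codes with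 $\limsup_{n}\mathrm{E}[b(X^n)]\leq B$, $P_e^{(n)}\to 0$, and $D(\widehat{P}_{Z^n}\|Q_0^{\times n})\to 0$. The covert capacity $C_{\mathrm{c}}$ (causal CSI) resp. $C_{\mathrm{nc}}$ (noncausal CSI) is the supremum of achievable rates. *)

(* Defs.v *)
From HB Require Import structures.
From mathcomp Require Import all_boot.
From Stdlib Require Import Reals.

Set Implicit Arguments.
Unset Strict Implicit.
Unset Printing Implicit Defensive.

Lemma Rplus_assoc' : associative Rplus.
Proof. by move=> x y z; rewrite Rplus_assoc. Qed.
Lemma Rmult_assoc' : associative Rmult.
Proof. by move=> x y z; rewrite Rmult_assoc. Qed.
HB.instance Definition _ :=
  Monoid.isComLaw.Build R 0%R Rplus Rplus_assoc' Rplus_comm Rplus_0_l.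
HB.instance Definition _ :=
  Monoid.isComLaw.Build R 1%R Rmult Rmult_assoc' Rmult_comm Rmult_1_l.

Notation "\rsum_ ( i : T ) F" := (\big[Rplus/0%R]_(i : T) F)
  (at level 41, F at level 41, i at level 50).
Notation "\rsum_ ( i | P ) F" := (\big[Rplus/0%R]_(i | P) F)
  (at level 41, F at level 41, i at level 50).
Notation "\rprod_ ( i < n ) F" := (\big[Rmult/1%R]_(i < n) F)
  (at level 36, F at level 36, i at level 50).

Open Scope R_scope.

Definition log2 (x : R) : R := ln x / ln 2.

Definition plogq (p q : R) : R :=
  if Req_EM_T p 0 then 0 else p * log2 (p / q).

Definition MI (A B : finType) (PAB : A -> B -> R) : R :=
  \rsum_(a : A) \rsum_(b : B)
     plogq (PAB a b) ((\rsum_(b' : B) PAB a b') * (\rsum_(a' : A) PAB a' b)).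

Definition KL (T : finType) (P Q : T -> R) : R :=
  \rsum_(t : T) plogq (P t) (Q t).

(* ceiling of a real, as a natural number (negative values clamp to 0) *)
Definition ceil_nat (r : R) : nat := Z.to_nat (1 - up (- r))%Z.

Definition is_pmf (T : finType) (P : T -> R) : Prop :=
  (forall t, 0 <= P t) /\ \rsum_(t : T) P t = 1.

Section Model.
Variables (X S Y Z : finType).
Variable PS : S -> R.
Variable W : S -> X -> Y -> Z -> R.
Variable x0 : X.                        (* "no input" symbol *)
Variable b : X -> R.

Definition Q0 (z : Z) : R := \rsum_(s : S) PS s * \rsum_(y : Y) W s x0 y z.

(* A (2^{nR}, 2^{nR_K}, n) code with noncausal CSI, with message set 'I_Mn
   and key set 'I_Kn.  The encoder is stochastic (private randomness):
   enc m k s^n is a PMF on X^n. *)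
Record nc_code (n Mn Kn : nat) := NCCode {
  enc : 'I_Mn -> 'I_Kn -> {ffun 'I_n -> S} -> {ffun 'I_n -> X} -> R;
  dec : {ffun 'I_n -> Y} -> 'I_Kn -> 'I_Mn;
  enc_pmf : forall m k s, is_pmf (enc m k s)
}.

Definition joint n Mn Kn (c : nc_code n Mn Kn) (m : 'I_Mn) (k : 'I_Kn)
  (s : {ffun 'I_n -> S}) (x : {ffun 'I_n -> X})
  (y : {ffun 'I_n -> Y}) (z : {ffun 'I_n -> Z}) : R :=
  / INR Mn * / INR Kn * (\rprod_(i < n) PS (s i)) * enc c m k s x
  * \rprod_(i < n) W (s i) (x i) (y i) (z i).

Definition err_prob n Mn Kn (c : nc_code n Mn Kn) : R :=
  \rsum_(m : 'I_Mn) \rsum_(k : 'I_Kn) \rsum_(s : {ffun 'I_n -> S})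
  \rsum_(x : {ffun 'I_n -> X}) \rsum_(y : {ffun 'I_n -> Y})
  \rsum_(z : {ffun 'I_n -> Z})
    (if dec c y k != m then joint c m k s x y z else 0).

Definition avg_cost n (x : {ffun 'I_n -> X}) : R :=
  / INR n * \rsum_(i : 'I_n) b (x i).

Definition exp_cost n Mn Kn (c : nc_code n Mn Kn) : R :=
  \rsum_(m : 'I_Mn) \rsum_(k : 'I_Kn) \rsum_(s : {ffun 'I_n -> S})
  \rsum_(x : {ffun 'I_n -> X}) \rsum_(y : {ffun 'I_n -> Y})
  \rsum_(z : {ffun 'I_n -> Z}) joint c m k s x y z * avg_cost x.

Definition warden_dist n Mn Kn (c : nc_code n Mn Kn) (z : {ffun 'I_n -> Z}) : R :=
  \rsum_(m : 'I_Mn) \rsum_(k : 'I_Kn) \rsum_(s : {ffun 'I_n -> S})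
  \rsum_(x : {ffun 'I_n -> X}) \rsum_(y : {ffun 'I_n -> Y}) joint c m k s x y z.

Definition Q0n n (z : {ffun 'I_n -> Z}) : R := \rprod_(i < n) Q0 (z i).

(* message and key set sizes: [1:2^{nR}] = {1,...,2^{ceil(nR)}} *)
Definition set_size (n : nat) (r : R) : nat := expn 2 (ceil_nat (INR n * r)).

Definition nc_achievable (RK B Rt : R) : Prop :=
  0 <= Rt /\
  exists c : forall n, nc_code n (set_size n Rt) (set_size n RK),
    (forall eps, 0 < eps -> exists N, forall n, (N <= n)%nat ->
        exp_cost (c n) <= B + eps) /\
    Un_cv (fun n => err_prob (c n)) 0 /\
    Un_cv (fun n => KL (warden_dist (c n)) (@Q0n n)) 0.

Section SingleLetter.
Variable U : finType.
Variable PUS : S -> U -> R.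
Variable xf : U -> S -> X.

Definition jP (s : S) (u : U) (x : X) (y : Y) (z : Z) : R :=
  PS s * PUS s u * (if x == xf u s then 1 else 0) * W s x y z.

Definition P_UY (u : U) (y : Y) : R :=
  \rsum_(s : S) \rsum_(x : X) \rsum_(z : Z) jP s u x y z.
Definition P_UZ (u : U) (z : Z) : R :=
  \rsum_(s : S) \rsum_(x : X) \rsum_(y : Y) jP s u x y z.
Definition P_US (u : U) (s : S) : R :=
  \rsum_(x : X) \rsum_(y : Y) \rsum_(z : Z) jP s u x y z.
Definition P_Z (z : Z) : R :=
  \rsum_(s : S) \rsum_(u : U) \rsum_(x : X) \rsum_(y : Y) jP s u x y z.
Definition E_bX : R :=
  \rsum_(s : S) \rsum_(u : U) \rsum_(x : X) \rsum_(y : Y) \rsum_(z : Z)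
    jP s u x y z * b x.

Definition I_UY : R := MI P_UY.
Definition I_UZ : R := MI P_UZ.
Definition I_US : R := MI P_US.
End SingleLetter.

End Model.

(* Main.v *)
Require Import Defs.
From HB Require Import structures.
From mathcomp Require Import all_boot.
From Stdlib Require Import Reals Lra FunctionalExtensionality.
From Stdlib Require Znat.

(** Random Gelfand-Pinsker coding with a likelihood encoder.  Draw codewords
    [u(m, k, l)] iid from the [U]-marginal.  In the ideal law [l] is uniform,
    the state is the output of the channel [P_{S|U}], and the receiver and the
    warden see the outputs of [P_{Y|U}] and [P_{Z|U}].  Given [(m, k, s)] the
    transmitter samples [l] from the ideal posterior, so the actual and the ideal
    laws differ only in the law of the state given [(m, k)].  Soft covering makes
    this difference small when the rate of [l] exceeds [I(U;S)], and makes the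
    ideal law of [Z^n] close to [Q_0^n] when the total rate, key included,
    exceeds [I(U;Z)]; threshold decoding works when the rate of [(m, l)] is below
    [I(U;Y)].  Chernoff bounds make all these gaps exponentially small, which
    compensates the factor [O(n)] lost between variational distance and
    divergence.  A codebook minimising (cost) + (large weight) * (gaps) meets all
    the constraints at once, since the mean of the ideal cost is exactly
    [E b(X)].  For a negative target the rate [0] suffices: then no message can be
    confused and the rate of [l] may be taken as large as the coverings need. *)

Set Implicit Arguments.
Unset Strict Implicit.
Unset Printing Implicit Defensive.

(** * Real analysis *)

Section RealAnalysis.
Local Open Scope R_scope.

Lemma ln2_pos : 0 < ln 2.
Proof. by rewrite -ln_1; apply: ln_increasing; lra. Qed.

(** From [exp (- x) >= 1 - x] one gets [exp x <= 1 / (1 - x)], and [(1 + x + 2 x^2) (1 - x) = 1 +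
    x^2 (1 - 2 x)] is at least 1 for [x <= 1 / 2]. *)
Lemma exp_quadratic_bound x : x <= / 2 -> exp x <= 1 + x + 2 * (x * x).
Proof.
move=> x_le; have ep := exp_pos x.
have : exp x * exp (- x) = 1 by rewrite -exp_plus Rplus_opp_r exp_0.
have := exp_ineq1_le (- x); set y := exp (- x) => y_ge xy1.
apply: (Rmult_le_reg_r (1 - x)); first by lra.
apply: (Rle_trans _ 1); first by rewrite -xy1; apply: Rmult_le_compat_l; lra.
have := Rle_0_sqr x; rewrite /Rsqr => xx.
have : 0 <= (x * x) * (1 - 2 * x) by apply: Rmult_le_pos; lra.
by lra.
Qed.

Lemma ln_le_sub1 x : 0 < x -> ln x <= x - 1.
Proof. by move=> x0; have := exp_ineq1_le (ln x); rewrite exp_ln //; lra. Qed.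

(** Termwise Gibbs inequality, from [ln (q / p) <= q / p - 1]; summed over two distributions the
    left side vanishes. *)
Lemma plogq_ge p q : 0 <= p -> 0 < q -> (p - q) / ln 2 <= plogq p q.
Proof.
move=> p0 q0; have l2 := ln2_pos.
have il2 : 0 < / ln 2 by apply: Rinv_0_lt_compat.
rewrite /plogq /log2; case: Req_EM_T => [pE|pN0] /=.
  rewrite pE; have : 0 < q * / ln 2 by apply: Rmult_lt_0_compat.
  by rewrite /Rdiv; lra.
have pp : 0 < p by lra.
have := ln_le_sub1 (Rdiv_lt_0_compat _ _ q0 pp).
rewrite (_ : q / p = / (p / q)); last by field; split; lra.
rewrite ln_Rinv; last exact: Rdiv_lt_0_compat.
move=> h; rewrite /Rdiv -Rmult_assoc; apply: Rmult_le_compat_r; first by lra.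
have := Rmult_le_compat_l p _ _ p0 h.
rewrite (_ : p * (/ (p / q) - 1) = q - p); last by field; split; lra.
by rewrite /Rdiv; lra.
Qed.

(* For [p > q], split [p ln (p / q)] as [q ln (p / q) + (p - q) ln (p / q)]. *)
Lemma plogq_le p q c : 0 <= p <= 1 -> 0 < q -> - ln q <= c -> 0 <= c ->
  plogq p q <= (1 + c) / ln 2 * Rabs (p - q).
Proof.
move=> [p0 p1] q0 qc c0.
have l2 := ln2_pos.
have il2 : 0 < / ln 2 by apply: Rinv_0_lt_compat.
have rhs0 : 0 <= (1 + c) / ln 2 * Rabs (p - q).
  apply: Rmult_le_pos; last exact: Rabs_pos.
  by apply: Rmult_le_pos; lra.
rewrite /plogq /log2; case: Req_EM_T => [//|pN0].
have pp : 0 < p by lra.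
have pq0 : 0 < p / q by apply: Rdiv_lt_0_compat.
have lnE : ln (p / q) = ln p - ln q.
  by rewrite /Rdiv ln_mult ?ln_Rinv //; apply: Rinv_0_lt_compat.
case: (Rle_lt_dec p q) => [pq|qp].
  apply: Rle_trans rhs0; have : ln (p / q) <= 0.
    rewrite lnE; case: pq => [pq|->]; last by lra.
    by have := ln_increasing _ _ pp pq; lra.
  move=> lnp; have : 0 <= p * (- ln (p / q)) * / ln 2.
    by do 2?apply: Rmult_le_pos; lra.
  by rewrite /Rdiv -Rmult_assoc; lra.
rewrite Rabs_pos_eq; last by lra.
have lnp : ln p <= 0 by have := ln_le_sub1 pp; lra.
have h1 : q * ln (p / q) <= p - q.
  have := Rmult_le_compat_l q _ _ (Rlt_le _ _ q0) (ln_le_sub1 pq0).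
  by rewrite (_ : q * (p / q - 1) = p - q) //; field; lra.
have h2 : (p - q) * ln (p / q) <= (p - q) * c by apply: Rmult_le_compat_l; lra.
rewrite /Rdiv -Rmult_assoc (_ : (1 + c) * / ln 2 * (p - q) = (1 + c) * (p - q) * / ln 2);
  last by ring.
by apply: Rmult_le_compat_r; rewrite -/(p / q); lra.
Qed.

(** Half of the decay absorbs the linear factor: with [g = sqrt f], Bernoulli's inequality bounds
    [n g^n] by [1 / h] for [h = 1 / g - 1], and the other factor [g^n] tends to 0. *)
Lemma linear_mul_pow_cv a b f : 0 < f < 1 -> Un_cv (fun n => (a + b * INR n) * f ^ n) 0.
Proof.
move=> [f0 f1]; set g := sqrt f.
have g0 : 0 < g by apply: sqrt_lt_R0.
have gg : g * g = f by apply: sqrt_sqrt; lra.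
have g1 : g < 1.
  by rewrite -[X in _ < X]sqrt_1; apply: sqrt_lt_1; lra.
pose h := / g - 1.
have h0 : 0 < h.
  by have := Rinv_lt_contravar g 1; rewrite Rinv_1 Rmult_1_r /h => /(_ g0 g1); lra.
have ng n : INR n * g ^ n <= / h.
  have := poly n h h0; rewrite /h (_ : 1 + (/ g - 1) = / g); last by ring.
  rewrite pow_inv => bern; have gn := pow_lt _ n g0.
  apply: (Rmult_le_reg_r h _ _ h0); rewrite Rinv_l; last exact: Rgt_not_eq.
  have := Rmult_le_compat_r (g ^ n) _ _ (Rlt_le _ _ gn) bern.
  by rewrite Rinv_l -/h; [lra|exact: Rgt_not_eq].
pose k := Rabs a + Rabs b * / h.
have k0 : 0 <= k.
  have := Rabs_pos a; have := Rabs_pos b => b0 a0.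
  have : 0 <= Rabs b * / h by apply: Rmult_le_pos => //; apply/Rlt_le/Rinv_0_lt_compat.
  by rewrite /k; lra.
move=> eps eps0.
(* The [+ 1] keeps the divisor positive when [a] and [b] vanish. *)
have [||N HN] := pow_lt_1_zero g _ (eps / (k + 1)).
- by rewrite Rabs_pos_eq; lra.
- by apply: Rdiv_lt_0_compat; lra.
exists N => n /HN; rewrite /R_dist /Rdist Rminus_0_r => gn.
have gn0 := pow_lt _ n g0; rewrite Rabs_pos_eq in gn; last by lra.
rewrite -gg Rpow_mult_distr -Rmult_assoc Rabs_mult (Rabs_pos_eq (g ^ n)); last by lra.
have gn1 : g ^ n <= 1 by rewrite -(pow1 n); apply: pow_incr; lra.
apply: (Rle_lt_trans _ (k * g ^ n)).
  apply: Rmult_le_compat_r; first by lra.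
  rewrite Rmult_plus_distr_r; apply: Rle_trans (Rabs_triang _ _) _.
  apply: Rplus_le_compat.
    rewrite Rabs_mult (Rabs_pos_eq (g ^ n)); last by lra.
    rewrite -[X in _ <= X]Rmult_1_r; apply: Rmult_le_compat_l => //; exact: Rabs_pos.
  rewrite Rmult_assoc Rabs_mult; apply: Rmult_le_compat_l; first exact: Rabs_pos.
  by rewrite Rabs_pos_eq //; apply: Rmult_le_pos; [exact: pos_INR|lra].
apply: (Rle_lt_trans _ ((k + 1) * g ^ n)); first by apply: Rmult_le_compat_r; lra.
have := Rmult_lt_compat_l (k + 1) _ _ _ gn.
rewrite (_ : (k + 1) * (eps / (k + 1)) = eps); last by field; lra.
by apply; lra.
Qed.

Lemma ceil_nat_bounds x : 0 <= x -> x <= INR (ceil_nat x) < x + 1.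
Proof.
move=> x0; have [up1 up2] := archimed (- x); rewrite /ceil_nat.
(* Hence [Z.to_nat] does not clamp. *)
have upZ : (0 <= 1 - up (- x))%Z.
  by apply: le_IZR; rewrite minus_IZR; lra.
by rewrite INR_IZR_INZ Znat.Z2Nat.id // minus_IZR; lra.
Qed.

Lemma INR_expn2 k : INR (expn 2 k) = exp (INR k * ln 2).
Proof.
elim: k => [|k IH]; first by rewrite /= Rmult_0_l exp_0.
rewrite expnS mult_INR IH (S_INR k) Rmult_plus_distr_r Rmult_1_l exp_plus.
by rewrite exp_ln /=; lra.
Qed.

Lemma exp_pow x n : exp x ^ n = exp (INR n * x).
Proof.
elim: n => [|n IH]; first by rewrite /= Rmult_0_l exp_0.
by rewrite S_INR -tech_pow_Rmult IH -exp_plus; congr exp; ring.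
Qed.

(** Rounding the exponent up costs at most a factor 2. *)
Lemma set_size_bounds n r : 0 <= r ->
  exp (r * ln 2) ^ n <= INR (set_size n r) <= 2 * exp (r * ln 2) ^ n.
Proof.
move=> r0; rewrite exp_pow /set_size INR_expn2.
have nr0 : 0 <= INR n * r by apply: Rmult_le_pos => //; apply: pos_INR.
have [c1 c2] := ceil_nat_bounds nr0.
have l2 := ln2_pos.
have exp_le a b : a <= b -> exp a <= exp b.
  by case=> [/exp_increasing/Rlt_le//|->]; apply: Rle_refl.
rewrite -Rmult_assoc; split.
  by apply: exp_le; apply: Rmult_le_compat_r; lra.
have {2}<- : exp (ln 2) = 2 by apply: exp_ln; lra.
rewrite -exp_plus; apply: exp_le.
have := Rmult_le_compat_r _ _ _ (Rlt_le _ _ l2) (Rlt_le _ _ c2); lra.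
Qed.

End RealAnalysis.

(* These [ring], [field] and [lra] shadow Stdlib's, which the section above needs. *)
From mathcomp Require Import all_order all_algebra.
From mathcomp Require Import Rstruct ring lra.
From mathcomp Require boolp.
Import Order.TTheory GRing.Theory Num.Theory.
Local Close Scope R_scope.
Local Open Scope ring_scope.

(** * Soft covering and packing *)

Section Finite.
Variable K : realFieldType.
Implicit Types (A T I J : finType).

(** * Finite expectations and uniform means *)

Definition pmf T (p : T -> K) := (forall t, 0 <= p t) /\ \sum_t p t = 1.

Definition expect T (p f : T -> K) := \sum_t p t * f t.

Definition output A T (p : A -> K) (V : A -> T -> K) t := expect p (V^~ t).

Definition mean T (f : T -> K) := #|T|%:R^-1 * \sum_t f t.

Lemma expect_ge0 T (p f : T -> K) :
  (forall t, 0 <= p t) -> (forall t, 0 <= f t) -> 0 <= expect p f.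
Proof. by move=> p0 f0; apply: sumr_ge0 => t _; apply: mulr_ge0. Qed.

Lemma expect_le T (p f g : T -> K) :
  (forall t, 0 <= p t) -> (forall t, f t <= g t) -> expect p f <= expect p g.
Proof. by move=> p0 fg; apply: ler_sum => t _; apply: ler_wpM2l. Qed.

Lemma eq_expect T (p f g : T -> K) : f =1 g -> expect p f = expect p g.
Proof. by move=> fg; apply: eq_bigr => t _; rewrite fg. Qed.

Lemma expectD T (p f g : T -> K) :
  expect p (fun t => f t + g t) = expect p f + expect p g.
Proof. by rewrite /expect -big_split; apply: eq_bigr => t _; rewrite mulrDr. Qed.

Lemma expectZ T (p f : T -> K) c : expect p (fun t => c * f t) = c * expect p f.
Proof. by rewrite /expect mulr_sumr; apply: eq_bigr => t _; rewrite mulrCA. Qed.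

Lemma expect_cst T (p : T -> K) c : pmf p -> expect p (fun=> c) = c.
Proof. by case=> _ p1; rewrite /expect -mulr_suml p1 mul1r. Qed.

Lemma expect_sum T J (P : pred J) (p : T -> K) (f : J -> T -> K) :
  expect p (fun t => \sum_(j | P j) f j t) = \sum_(j | P j) expect p (f j).
Proof.
by rewrite /expect exchange_big; apply: eq_bigr => t _; rewrite mulr_sumr.
Qed.

Lemma expect_mean T J (p : T -> K) (f : J -> T -> K) :
  expect p (fun t => mean (f^~ t)) = mean (fun j => expect p (f j)).
Proof. by rewrite /mean expectZ expect_sum. Qed.

Lemma expect_le_cst T (p f : T -> K) c :
  pmf p -> (forall t, f t <= c) -> expect p f <= c.
Proof.
by move=> p_pmf fc; rewrite -[leRHS](expect_cst c p_pmf); apply: expect_le p_pmf.1 _.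
Qed.

(** The derandomisation step. If [f] exceeded its mean everywhere, the nonnegative terms
    [p t * (f t - mean)] would sum to 0, which forces [p] to vanish. *)
Lemma expect_attained T (p f : T -> K) : pmf p -> exists t, f t <= expect p f.
Proof.
move=> p_pmf; apply/existsP/negbNE/negP => /existsPn f_gt.
have p0 := p_pmf.1.
have: expect p (fun t => f t - expect p f) = 0.
  by rewrite expectD expect_cst // subrr.
have term0 t : 0 <= p t * (f t - expect p f).
  by rewrite mulr_ge0 // subr_ge0 ltW // ltNge f_gt.
move/eqP; rewrite /expect psumr_eq0 // => /allP p_zero.
have := p_pmf.2; rewrite big1 => [|t _]; first by move/eqP; rewrite eq_sym oner_eq0.
have := p_zero t (mem_index_enum _); rewrite mulf_eq0 => /orP[/eqP//|].
by rewrite subr_eq0 => /eqP ft; move: (f_gt t); rewrite ft lexx.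
Qed.

Lemma mean_ge0 T (f : T -> K) : (forall t, 0 <= f t) -> 0 <= mean f.
Proof. by move=> f0; rewrite mulr_ge0 ?invr_ge0 ?ler0n ?sumr_ge0. Qed.

Lemma mean_le T (f g : T -> K) : (forall t, f t <= g t) -> mean f <= mean g.
Proof. by move=> fg; rewrite ler_wpM2l ?invr_ge0 ?ler0n ?ler_sum. Qed.

Lemma eq_mean T (f g : T -> K) : f =1 g -> mean f = mean g.
Proof. by move=> fg; rewrite /mean (eq_bigr g). Qed.

Lemma meanZ T (f : T -> K) c : mean (fun t => c * f t) = c * mean f.
Proof. by rewrite /mean -mulr_sumr mulrCA. Qed.

Lemma meanD T (f g : T -> K) : mean (fun t => f t + g t) = mean f + mean g.
Proof. by rewrite /mean big_split mulrDr. Qed.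

Lemma mean_sum T J (f : J -> T -> K) :
  mean (fun t => \sum_j f j t) = \sum_j mean (f j).
Proof. by rewrite /mean exchange_big mulr_sumr. Qed.

Lemma mean_pair A T (f : A * T -> K) :
  mean f = mean (fun a => mean (fun t => f (a, t))).
Proof.
rewrite /mean (eq_bigr (fun at_ => f (at_.1, at_.2))) => [|[]//].
rewrite -(pair_bigA _ (fun a t => f (a, t))) card_prod natrM invfM -mulr_sumr mulrA.
by [].
Qed.

Lemma mean_cst T (c : K) : (0 < #|T|)%nat -> mean (fun _ : T => c) = c.
Proof.
move=> T0; rewrite /mean sumr_const -[c *+ _]mulr_natl mulrA mulVf ?mul1r //.
by rewrite pnatr_eq0 -lt0n.
Qed.

Lemma mean_le_cst T (f : T -> K) (c : K) :
  (0 < #|T|)%nat -> (forall t, f t <= c) -> mean f <= c.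
Proof. by move=> T0 fc; rewrite -[leRHS](mean_cst c T0) mean_le. Qed.

Lemma ler_norm_mean T (f : T -> K) : `|mean f| <= mean (fun t => `|f t|).
Proof.
rewrite /mean normrM ger0_norm ?invr_ge0 ?ler0n //.
by rewrite ler_wpM2l ?invr_ge0 ?ler0n ?ler_norm_sum.
Qed.

(** * IID codebooks *)

Definition iid I A (p : A -> K) (C : {ffun I -> A}) := \prod_i p (C i).

Lemma sum_ffun_prod I A (F : I -> A -> K) :
  \sum_(C : {ffun I -> A}) \prod_i F i (C i) = \prod_i \sum_a F i a.
Proof. by rewrite bigA_distr_bigA. Qed.

Lemma iid_pmf I A (p : A -> K) : pmf p -> pmf (@iid I A p).
Proof.
case=> p0 p1; split=> [C|]; first by rewrite prodr_ge0.
by rewrite (sum_ffun_prod (fun=> p)) big1.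
Qed.

(** Absorb [f] into the factor at [i] and exchange sum and product; every other factor sums to 1. *)
Lemma iid_expect1 I A (p f : A -> K) (i : I) : pmf p ->
  expect (iid p) (fun C : {ffun I -> A} => f (C i)) = expect p f.
Proof.
case=> p0 p1.
pose F k a := p a * (if k == i then f a else 1).
transitivity (\sum_(C : {ffun I -> A}) \prod_k F k (C k)).
  apply: eq_bigr => C _; rewrite big_split -big_mkcond /= big_pred1_eq.
  by [].
rewrite sum_ffun_prod (bigD1 i) //= [X in _ * X]big1 ?mulr1.
  by apply: eq_bigr => a _; rewrite /F eqxx.
by move=> k /negPf ki; rewrite -[RHS]p1; apply: eq_bigr => a _; rewrite /F ki mulr1.
Qed.

Lemma iid_expect2 I A (p f g : A -> K) (i j : I) : pmf p -> i != j ->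
  expect (iid p) (fun C : {ffun I -> A} => f (C i) * g (C j)) =
  expect p f * expect p g.
Proof.
move=> [p0 p1] ij.
pose F k a := p a * ((if k == i then f a else 1) * (if k == j then g a else 1)).
transitivity (\sum_(C : {ffun I -> A}) \prod_k F k (C k)).
  by apply: eq_bigr => C _; rewrite !big_split -!big_mkcond /= !big_pred1_eq.
rewrite sum_ffun_prod (bigD1 i) //= (bigD1 j) 1?eq_sym //= [X in _ * (_ * X)]big1 ?mulr1.
  congr (_ * _); apply: eq_bigr => a _.
    by rewrite /F eqxx (negPf ij) mulr1.
  by rewrite /F eqxx eq_sym (negPf ij) mul1r.
move=> k /andP[/negPf ki /negPf kj].
by rewrite -[RHS]p1; apply: eq_bigr => a _; rewrite /F ki kj !mulr1.
Qed.

(** The map [e] selects a subfamily of codewords. Being injective it makes the selected codewords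
    pairwise independent, so only the diagonal of the squared centred sum survives; the variance is
    at most the second moment. *)
Lemma mean_variance I J A (p h : A -> K) (e : J -> I) :
  pmf p -> injective e -> (0 < #|J|)%nat ->
  expect (iid p)
    (fun C : {ffun I -> A} => (mean (fun j => h (C (e j))) - expect p h) ^+ 2)
  <= expect p (fun a => h a ^+ 2) / #|J|%:R.
Proof.
move=> p_pmf e_inj J0; set mu := expect p h; set N := #|J|%:R.
have N0 : 0 < N by rewrite ltr0n.
pose hc a := h a - mu.
have hc0 : expect p hc = 0 by rewrite expectD expect_cst // subrr.
have var_le : expect p (fun a => hc a ^+ 2) <= expect p (fun a => h a ^+ 2).
  suff -> : expect p (fun a => h a ^+ 2) = expect p (fun a => hc a ^+ 2) + mu ^+ 2.
    by rewrite lerDl sqr_ge0.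
  transitivity (expect p (fun a => hc a ^+ 2 + (2 * mu * hc a + mu ^+ 2))).
    by apply: eq_bigr => a _; congr (_ * _); rewrite /hc; ring.
  by rewrite !expectD expectZ hc0 expect_cst // mulr0 add0r.
have sqE (C : {ffun I -> A}) : (mean (fun j => h (C (e j))) - mu) ^+ 2 =
    N^-1 ^+ 2 * \sum_j \sum_j' hc (C (e j)) * hc (C (e j')).
  rewrite -[mu](mean_cst _ J0) -[- _]mulN1r -meanZ -meanD exprMn.
  congr (_ * _); rewrite expr2 big_distrlr /=.
  by apply: eq_bigr => j _; apply: eq_bigr => j' _; rewrite !mulN1r.
rewrite (eq_expect _ sqE) expectZ expect_sum.
rewrite (eq_bigr (fun=> expect p (fun a => hc a ^+ 2))) => [|j _]; last first.
  rewrite expect_sum (bigD1 j) //= big1 ?addr0 => [|j' j'j].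
    exact: (iid_expect1 (fun a => hc a ^+ 2)).
  by rewrite iid_expect2 ?hc0 ?mul0r // (inj_eq e_inj) eq_sym.
rewrite sumr_const -mulr_natl -/N mulrA expr2 mulfVK ?gt_eqF // mulrC.
by rewrite ler_wpM2r // invr_ge0 ltW.
Qed.

(* Truncate [V] where it exceeds [tau] times its output.  The truncated part has
   mean-square deviation at most [tau q^2 / #|J|], and [|x| <= x^2 / (c q) + c q]
   turns this into an L1 bound; the discarded part contributes twice its mass. *)
Lemma soft_covering I J A T (p : A -> K) (V : A -> T -> K) (e : J -> I)
    (tau c : K) :
  pmf p -> (forall a, pmf (V a)) -> injective e -> (0 < #|J|)%nat ->
  0 <= tau -> 0 < c ->
  expect (iid p) (fun C : {ffun I -> A} =>
    \sum_t `|mean (fun j => V (C (e j)) t) - output p V t|) <=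
  tau / #|J|%:R / c + c +
  2 * \sum_t \sum_(a | tau * output p V t < V a t) p a * V a t.
Proof.
move=> p_pmf V_pmf e_inj J0 tau0 c0; set q := output p V; set N := #|J|%:R.
have N0 : 0 < N by rewrite ltr0n.
have [p0 p1] := p_pmf; have [iid0 _] := iid_pmf I p_pmf.
have V0 a t : 0 <= V a t by have [] := V_pmf a.
have q0 t : 0 <= q t by apply: expect_ge0.
have q1 : \sum_t q t = 1.
  rewrite -expect_sum -(expect_cst 1 p_pmf); apply: eq_bigr => a _.
  by rewrite (V_pmf a).2.
pose h t a := if tau * q t < V a t then 0 else V a t.
pose g t a := if tau * q t < V a t then V a t else 0.
have h0 t a : 0 <= h t a by rewrite /h; case: ifP.
have g0 t a : 0 <= g t a by rewrite /g; case: ifP.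
have VE t a : V a t = h t a + g t a by rewrite /h /g; case: ifP; rewrite ?addr0 ?add0r.
have gE t : expect p (g t) = \sum_(a | tau * q t < V a t) p a * V a t.
  by rewrite [RHS]big_mkcond; apply: eq_bigr => a _; rewrite /g; case: ifP; rewrite ?mulr0.
pose X f C := mean (fun j => f (C (e j))) - expect p f : K.
have EX (f : A -> K) :
    expect (iid p) (fun C : {ffun I -> A} => mean (fun j => f (C (e j)))) = expect p f.
  rewrite (expect_mean (iid p) (fun j C => f (C (e j)))) -[RHS](mean_cst _ J0).
  by apply: eq_mean => j; rewrite iid_expect1.
have absX f : (forall a, 0 <= f a) ->
    expect (iid p) (fun C : {ffun I -> A} => `|X f C|) <= 2 * expect p f.
  move=> f0; have f0' : 0 <= expect p f by apply: expect_ge0.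
  apply: le_trans (_ : expect (iid p) (fun C : {ffun I -> A} =>
     mean (fun j => f (C (e j))) + expect p f) <= _).
    apply: expect_le => // C; apply: le_trans (ler_normB _ _) _.
    by rewrite !ger0_norm // mean_ge0.
  rewrite expectD EX expect_cst ?mulr_natl //; exact: iid_pmf.
have hX t : expect (iid p) (fun C : {ffun I -> A} => `|X (h t) C|) <=
    (tau / N / c + c) * q t.
  have h_le_q : expect p (h t) <= q t.
    by apply: expect_le => // a; rewrite (VE t a) lerDl.
  (* Where [q t = 0] the weight [c * q t] cannot be inverted; there [h t] has mean at most
     [q t = 0], so the deviation has mean 0 too. *)
  have [qt0|qtN0] := eqVneq (q t) 0.
    apply: le_trans (absX _ (h0 t)) _; move: h_le_q; rewrite qt0 mulr0; lra.
  have qt : 0 < q t by rewrite lt_def qtN0 q0.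
  have cq : 0 < c * q t by apply: mulr_gt0.
  apply: le_trans (_ : expect (iid p) (fun C : {ffun I -> A} =>
     (c * q t)^-1 * X (h t) C ^+ 2 + c * q t) <= _).
    apply: expect_le => // C; set x := `|_|.
    have -> : X (h t) C ^+ 2 = x ^+ 2 by rewrite /x real_normK ?num_real.
    rewrite -(ler_pM2l cq) mulrDr mulrA divff ?gt_eqF // mul1r.
    have x0 : 0 <= x by apply: normr_ge0.
    nra.
  rewrite expectD expect_cst; last exact: iid_pmf.
  rewrite expectZ mulrDl lerD2r.
  (* The truncation bounds one factor of the square by [tau * q t]. *)
  have h2 : expect p (fun a => h t a ^+ 2) <= tau * q t * q t.
    apply: le_trans (_ : expect p (fun a => tau * q t * h t a) <= _).
      apply: expect_le => // a; rewrite expr2 ler_wpM2r //.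
      by rewrite /h; case: ltP => // _; rewrite mulr_ge0.
    by rewrite expectZ ler_wpM2l // mulr_ge0.
  rewrite ler_pdivrMl //; apply: le_trans (mean_variance (h t) p_pmf e_inj J0) _.
  rewrite ler_pdivrMr //; apply: le_trans h2 _.
  by rewrite le_eqVlt; apply/orP; left; apply/eqP; rewrite -/N; field; rewrite !gt_eqF.
rewrite -(eq_bigr _ (fun t _ => gE t)) expect_sum mulr_sumr.
apply: le_trans (_ : \sum_t ((tau / N / c + c) * q t + 2 * expect p (g t)) <= _); last first.
  by rewrite big_split /= -!mulr_sumr q1 mulr1.
apply: ler_sum => t _.
apply: le_trans (_ : expect (iid p) (fun C : {ffun I -> A} =>
   `|X (h t) C| + `|X (g t) C|) <= _); last first.
  by rewrite expectD lerD // absX.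
apply: expect_le => // C; apply: le_trans (ler_normD _ _).
rewrite /X le_eqVlt; apply/orP; left; apply/eqP; congr `|_|.
rewrite addrACA -meanD -opprD -expectD; congr (_ - _).
  by apply: eq_mean => j; rewrite -VE.
by apply: eq_bigr => a _; rewrite -VE.
Qed.

(** A threshold on the information density, multiplied out so that nothing is divided by a vanishing
    output. *)
Definition typical A T (p : A -> K) (V : A -> T -> K) tau a t :=
  tau * output p V t <= V a t.

(** [B] is the set of competitors of [i]. Their codewords are independent of the output of codeword
    [i]; since typicality means [q t <= V a t / tau], averaging over [a] shows that each passes the
    threshold with probability at most [1 / tau]. *)
Lemma packing I A T (p : A -> K) (V : A -> T -> K) (i : I) (B : pred I) (tau : K) :
  pmf p -> (forall a, pmf (V a)) -> ~~ B i -> 0 < tau ->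
  expect (iid p) (fun C : {ffun I -> A} =>
    \sum_t V (C i) t * ((~~ typical p V tau (C i) t)%:R +
                        \sum_(j | B j) (typical p V tau (C j) t)%:R)) <=
  \sum_t \sum_(a | V a t < tau * output p V t) p a * V a t + #|B|%:R / tau.
Proof.
move=> p_pmf V_pmf Bi tau0; set q := output p V; set typ := typical p V tau.
have [p0 p1] := p_pmf; have [iid0 _] := iid_pmf I p_pmf.
have V0 a t : 0 <= V a t by have [] := V_pmf a.
rewrite (@eq_expect _ _ _ (fun C : {ffun I -> A} =>
  \sum_t V (C i) t * (~~ typ (C i) t)%:R +
  \sum_(j | B j) \sum_t V (C i) t * (typ (C j) t)%:R)) => [|C]; last first.
  rewrite [X in _ + X]exchange_big -big_split; apply: eq_bigr => t _ /=.
  by rewrite mulrDr mulr_sumr.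
rewrite expectD; apply: lerD.
  rewrite expect_sum; apply: ler_sum => t _.
  rewrite (iid_expect1 (fun a => V a t * (~~ typ a t)%:R) i) // [leRHS]big_mkcond.
  apply: ler_sum => a _; rewrite /typ /typical -ltNge.
  by case: ifP; rewrite ?mulr1 ?mulr0.
rewrite expect_sum; apply: le_trans (_ : \sum_(j | B j) tau^-1 <= _); last first.
  by rewrite sumr_const -[leLHS]mulr_natl.
apply: ler_sum => j Bj; rewrite expect_sum.
rewrite (eq_bigr (fun t => q t * expect p (fun a => (typ a t)%:R))) => [|t _]; last first.
  rewrite (iid_expect2 (V^~ t) (fun a => (typ a t)%:R)) //.
  by apply: contraNneq Bi => ->.
apply: le_trans (_ : \sum_t tau^-1 * q t <= _); last first.
  suff -> : \sum_t tau^-1 * q t = tau^-1 by [].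
  rewrite -mulr_sumr -expect_sum -[RHS]mulr1 -[in RHS](expect_cst 1 p_pmf).
  by congr (_ * _); apply: eq_expect => a; rewrite (V_pmf a).2.
apply: ler_sum => t _; rewrite -expectZ -expectZ; apply: expect_le => // a.
rewrite /typ /typical; case: (leP (tau * q t)) => [tV|_]; last first.
  by rewrite mulr0 mulr_ge0 ?invr_ge0 // ltW.
by rewrite mulr1 ler_pdivlMl.
Qed.

End Finite.

(** * Random coding for a single use of the channel *)

Section StateChannel.
Variable K : realFieldType.
Variables A S X Y Z : finType.
Variables (PSA : A -> S -> K) (xf : A -> S -> X) (W : S -> X -> Y -> Z -> K).

(** Channels from a codeword to the receiver and to the warden in the ideal law, where the codeword
    produces the state. The letters will later be whole blocks, so a single use is enough here. *)
Definition chanY a y := \sum_s PSA a s * \sum_z W s (xf a s) y z.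
Definition chanZ a z := \sum_s PSA a s * \sum_y W s (xf a s) y z.

Hypothesis PSA_pmf : forall a, pmf (PSA a).
Hypothesis W_pmf : forall s x, pmf (fun yz : Y * Z => W s x yz.1 yz.2).

Lemma W_ge0 s x y z : 0 <= W s x y z.
Proof. by have [/(_ (y, z))] := W_pmf s x. Qed.

Lemma W_sumYZ s x : \sum_y \sum_z W s x y z = 1.
Proof. by rewrite pair_bigA; have [_ <-] := W_pmf s x; apply: eq_bigr. Qed.

Lemma chanY_pmf a : pmf (chanY a).
Proof.
have [PSA0 PSA1] := PSA_pmf a; split=> [y|].
  by apply: sumr_ge0 => s _; rewrite mulr_ge0 ?sumr_ge0 // => z _; apply: W_ge0.
rewrite exchange_big -[RHS]PSA1; apply: eq_bigr => s _ /=.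
by rewrite -mulr_sumr W_sumYZ mulr1.
Qed.

Lemma chanZ_pmf a : pmf (chanZ a).
Proof.
have [PSA0 PSA1] := PSA_pmf a; split=> [z|].
  by apply: sumr_ge0 => s _; rewrite mulr_ge0 ?sumr_ge0 // => y _; apply: W_ge0.
rewrite exchange_big -[RHS]PSA1; apply: eq_bigr => s _ /=.
by rewrite -mulr_sumr exchange_big W_sumYZ mulr1.
Qed.

Variables (nM nK nL : nat).
Hypotheses (nM0 : (0 < nM)%nat) (nK0 : (0 < nK)%nat) (nL0 : (0 < nL)%nat).
Variable PS : S -> K.

Definition law (enc : 'I_nM -> 'I_nK -> S -> X -> K) m k s x y z :=
  nM%:R^-1 * nK%:R^-1 * PS s * enc m k s x * W s x y z.

Lemma law_ge0 enc m k s x y z :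
  (forall s, 0 <= PS s) -> (forall m k s, pmf (enc m k s)) -> 0 <= law enc m k s x y z.
Proof.
move=> PS0 enc_pmf; have enc0 : 0 <= enc m k s x by have [] := enc_pmf m k s.
by rewrite !mulr_ge0 ?invr_ge0 ?ler0n ?W_ge0.
Qed.

Lemma law_warden_pmf enc : pmf PS -> (forall m k s, pmf (enc m k s)) ->
  pmf (fun z => \sum_m \sum_k \sum_s \sum_x \sum_y law enc m k s x y z).
Proof.
move=> PS_pmf enc_pmf; split=> [z|].
  by do 5![apply: sumr_ge0 => ? _]; apply: law_ge0 => //; have [] := PS_pmf.
have inv_sum n : (0 < n)%nat -> \sum_(i < n) n%:R^-1 = 1 :> K.
  move=> n0; rewrite sumr_const card_ord -[_ *+ _]mulr_natr mulVf //.
  by rewrite pnatr_eq0 -lt0n.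
rewrite exchange_big -[RHS](inv_sum nM) //; apply: eq_bigr => m _.
rewrite exchange_big -[RHS]mulr1 -[X in _ = _ * X](inv_sum nK) // mulr_sumr.
apply: eq_bigr => k _.
rewrite exchange_big -[RHS]mulr1 -[X in _ = _ * X]PS_pmf.2 mulr_sumr; apply: eq_bigr => s _.
rewrite exchange_big -[RHS]mulr1 -[X in _ = _ * X](enc_pmf m k s).2 mulr_sumr.
apply: eq_bigr => x _; rewrite exchange_big -[RHS]mulr1 -[X in _ = _ * X](W_sumYZ s x) mulr_sumr.
by apply: eq_bigr => y _; rewrite mulr_sumr.
Qed.

Local Notation I := ('I_nM * 'I_nK * 'I_nL)%type.

(** The ideal law of the state given [(m, k)], which soft covering brings close to [PS]. *)
Definition state_out (C : I -> A) m k s := mean (fun l : 'I_nL => PSA (C (m, k, l)) s).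

(* The ideal posterior of [l]; uniform when the ideal law never produces [s]. *)
Definition likelihood (C : I -> A) m k s l :=
  if state_out C m k s == 0 then nL%:R^-1
  else nL%:R^-1 * PSA (C (m, k, l)) s / state_out C m k s.

Definition likelihood_enc (C : I -> A) m k s x :=
  \sum_l likelihood C m k s l * (x == xf (C (m, k, l)) s)%:R.

(** * Ideal and actual laws for a fixed codebook *)

Section FixedCodebook.
Variable C : I -> A.

Let PSA_ge0 a s : 0 <= PSA a s. Proof. by have [] := PSA_pmf a. Qed.

Lemma state_out_ge0 m k s : 0 <= state_out C m k s.
Proof. by apply: mean_ge0. Qed.

Lemma likelihood_pmf m k s : pmf (likelihood C m k s).
Proof.
rewrite /likelihood; case: eqP => [_|/eqP out0]; split=> [l|].
- by rewrite invr_ge0 ler0n.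
- by rewrite sumr_const card_ord -[_ *+ _]mulr_natr mulVf // pnatr_eq0 -lt0n.
- by rewrite divr_ge0 ?state_out_ge0 // mulr_ge0 ?invr_ge0 ?ler0n.
rewrite -mulr_suml -mulr_sumr -[X in X%:R^-1]card_ord -/(mean _).
exact: divff.
Qed.

Lemma likelihood_encE m k s (f : X -> K) :
  \sum_x likelihood_enc C m k s x * f x =
  \sum_l likelihood C m k s l * f (xf (C (m, k, l)) s).
Proof.
under eq_bigr => x _ do rewrite mulr_suml.
rewrite exchange_big; apply: eq_bigr => l _; rewrite (bigD1 (xf (C (m, k, l)) s)) //=.
rewrite eqxx mulr1 big1 ?addr0 // => x /negPf->.
by rewrite mulr0 mul0r.
Qed.

Lemma likelihood_enc_pmf m k s : pmf (likelihood_enc C m k s).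
Proof.
have [l0 l1] := likelihood_pmf m k s; split=> [x|].
  by apply: sumr_ge0 => l _; rewrite mulr_ge0 // ler0n.
have := likelihood_encE m k s (fun=> 1).
by under eq_bigr do rewrite mulr1; move=> ->; under eq_bigr do rewrite mulr1.
Qed.

(** Bayes' rule. It survives [state_out = 0], since then every codeword with indices [(m, k)] gives
    [s] probability 0. *)
Lemma state_out_likelihood m k s l :
  state_out C m k s * likelihood C m k s l = nL%:R^-1 * PSA (C (m, k, l)) s.
Proof.
rewrite /likelihood; case: eqP => [out0|/eqP out0]; last first.
  by rewrite mulrCA divff // mulr1.
rewrite out0 mul0r; move/eqP: out0; rewrite /state_out /mean mulf_eq0 invr_eq0.
rewrite pnatr_eq0 card_ord gtn_eqF //= psumr_eq0 // => /allP/(_ l (mem_index_enum _)).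
by move=> /eqP->; rewrite mulr0.
Qed.

(** Mean of [f] when [(m, k, l)] is uniform and the codeword produces the state. *)
Definition ideal (f : 'I_nM -> 'I_nK -> S -> X -> K) :=
  mean (fun i : I => \sum_s PSA (C i) s * f i.1.1 i.1.2 s (xf (C i) s)).

(** Mean of [f] when the state has law [PS], independent of [(m, k)], and the encoder answers it. *)
Definition actual (f : 'I_nM -> 'I_nK -> S -> X -> K) :=
  mean (fun mk => \sum_s PS s *
          \sum_x likelihood_enc C mk.1 mk.2 s x * f mk.1 mk.2 s x).

Definition state_gap :=
  mean (fun mk => \sum_s `|state_out C mk.1 mk.2 s - PS s|).

(** By Bayes' rule the ideal law may draw [s] from [state_out] first and then use the very same
    encoder, so that only the law of the state differs from [actual]. *)
Lemma idealE f : ideal f =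
  mean (fun mk => \sum_s state_out C mk.1 mk.2 s *
          \sum_x likelihood_enc C mk.1 mk.2 s x * f mk.1 mk.2 s x).
Proof.
rewrite /ideal mean_pair.
apply: eq_mean => -[m k]; rewrite mean_sum; apply: eq_bigr => s _ /=.
rewrite likelihood_encE mulr_sumr /mean mulr_sumr; apply: eq_bigr => l _.
by rewrite [RHS]mulrA state_out_likelihood card_ord mulrA.
Qed.

Lemma actual_sub_ideal f : actual f - ideal f =
  mean (fun mk => \sum_s (PS s - state_out C mk.1 mk.2 s) *
          \sum_x likelihood_enc C mk.1 mk.2 s x * f mk.1 mk.2 s x).
Proof.
rewrite idealE -mulN1r -meanZ -meanD; apply: eq_mean => mk.
by rewrite mulN1r -sumrB; apply: eq_bigr => s _; rewrite mulrBl.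
Qed.

Lemma actual_le_ideal f c :
  (forall m k s x, 0 <= f m k s x <= c) -> actual f <= ideal f + c * state_gap.
Proof.
move=> fc; rewrite -lerBlDl actual_sub_ideal -meanZ; apply: mean_le => -[m k] /=.
rewrite mulr_sumr; apply: ler_sum => s _.
have enc_pmf := likelihood_enc_pmf m k s.
set e := \sum_x _; have e0 : 0 <= e.
  by apply: expect_ge0 enc_pmf.1 _ => x; case/andP: (fc m k s x).
have ec : e <= c by apply: (expect_le_cst enc_pmf) => x; case/andP: (fc m k s x).
apply: le_trans (ler_norm _) _; rewrite normrM distrC mulrC (ger0_norm e0).
by rewrite ler_wpM2r.
Qed.

(** Data processing: [f] is a channel into [Z] common to both laws, so it cannot increase the L1
    distance. *)
Lemma actual_ideal_dist (f : Z -> 'I_nM -> 'I_nK -> S -> X -> K) :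
  (forall z m k s x, 0 <= f z m k s x) ->
  (forall m k s x, \sum_z f z m k s x = 1) ->
  \sum_z `|actual (f z) - ideal (f z)| <= state_gap.
Proof.
move=> f0 f1.
apply: le_trans (_ : \sum_z mean (fun mk => \sum_s `|PS s - state_out C mk.1 mk.2 s| *
          \sum_x likelihood_enc C mk.1 mk.2 s x * f z mk.1 mk.2 s x) <= _).
  apply: ler_sum => z _; rewrite actual_sub_ideal.
  apply: le_trans (ler_norm_mean _) _; apply: mean_le => -[m k] /=.
  apply: le_trans (ler_norm_sum _ _ _) _; apply: ler_sum => s _.
  rewrite normrM [X in _ * X]ger0_norm //.
  by apply: expect_ge0 => [x|x]; rewrite ?(likelihood_enc_pmf m k s).1.
rewrite -mean_sum; apply: mean_le => -[m k] /=.
rewrite exchange_big; apply: ler_sum => s _ /=.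
rewrite -mulr_sumr exchange_big /= (eq_bigr (likelihood_enc C m k s)) => [|x _].
  by rewrite (likelihood_enc_pmf m k s).2 mulr1 distrC.
by rewrite -mulr_sumr f1 mulr1.
Qed.

Lemma law_actual f :
  \sum_m \sum_k \sum_s \sum_x
    nM%:R^-1 * nK%:R^-1 * PS s * likelihood_enc C m k s x * f m k s x = actual f.
Proof.
rewrite /actual /mean card_prod !card_ord natrM invfM.
rewrite -(pair_bigA _ (fun m k => \sum_s PS s *
  \sum_x likelihood_enc C m k s x * f m k s x)) /=.
do 3![rewrite mulr_sumr; apply: eq_bigr => ? _].
by rewrite mulrA mulr_sumr; apply: eq_bigr => x _; rewrite !mulrA.
Qed.

Lemma ideal_chanY (h : Y -> 'I_nM -> 'I_nK -> K) :
  ideal (fun m k s x => \sum_y \sum_z W s x y z * h y m k) =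
  mean (fun i => \sum_y chanY (C i) y * h y i.1.1 i.1.2).
Proof.
apply: eq_mean => i; rewrite (eq_bigr (fun s => \sum_y PSA (C i) s *
  (\sum_z W s (xf (C i) s) y z) * h y i.1.1 i.1.2)) => [|s _].
  by rewrite exchange_big; apply: eq_bigr => y _; rewrite mulr_suml.
by rewrite mulr_sumr; apply: eq_bigr => y _; rewrite -mulr_suml mulrA.
Qed.

Lemma ideal_chanZ z :
  ideal (fun m k s x => \sum_y W s x y z) = mean (fun i => chanZ (C i) z).
Proof. by []. Qed.

End FixedCodebook.

(** * Averages over the random codebook, and choice of one codebook *)

Section RandomCodebook.
Variables (pA : A -> K) (b : X -> K) (bmax : K).
Hypothesis pA_pmf : pmf pA.
Hypothesis PS_out : forall s, output pA PSA s = PS s.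
Hypothesis b_bound : forall x, 0 <= b x <= bmax.
Variables (tS tY tZ cS cZ lam : K).
Hypotheses (tS0 : 0 <= tS) (tY0 : 0 < tY) (tZ0 : 0 <= tZ) (cS0 : 0 < cS) (cZ0 : 0 < cZ).
Hypotheses (lam0 : 0 <= lam) (bmax0 : 0 <= bmax).

(** Picks a message owning a typical codeword under the key [k]. The default message is used only
    when the sent codeword fails the threshold as well, which already counts as an error. *)
Definition decoder (C : I -> A) y k :=
  odflt (Ordinal nM0) [pick m | [exists l, typical pA chanY tY (C (m, k, l)) y]].

(* The decoder knows the key, so only codewords with the same key compete. *)
Definition confusable (i : I) : pred I :=
  fun j => (j.1.1 != i.1.1) && (j.1.2 == i.1.2).

(** Union bound for decoding under the ideal law: the sent codeword fails the threshold or a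
    competitor passes it. *)
Definition error_score (C : I -> A) :=
  mean (fun i => \sum_y chanY (C i) y * ((~~ typical pA chanY tY (C i) y)%:R +
     \sum_(j | confusable i j) (typical pA chanY tY (C j) y)%:R)).

(** If the sent codeword is typical, the decoder finds some message, and the codeword witnessing a
    wrong one is confusable with the sent one. *)
Lemma decoder_error C (i : I) y :
  (decoder C y i.1.2 != i.1.1)%:R <=
  (~~ typical pA chanY tY (C i) y)%:R +
     \sum_(j | confusable i j) (typical pA chanY tY (C j) y)%:R :> K.
Proof.
have sum0 (P : pred I) : 0 <= \sum_(j | P j) (typical pA chanY tY (C j) y)%:R :> K.
  by apply: sumr_ge0 => j _; rewrite ler0n.
case: i => -[m k] l /=; case typ_i: (typical _ _ _ _ _); last first.
  by rewrite -[leLHS]addr0 lerD // lern1 leq_b1.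
rewrite add0r /decoder; case: pickP => [m' /existsP[l' typ_j]|/(_ m)]; last first.
  by move=> /negbT/existsPn/(_ l); rewrite typ_i.
have [_|m'm] /= := eqVneq m' m; first exact: sum0.
rewrite (bigD1 (m', k, l')) /=; last by rewrite /confusable /= m'm eqxx.
by rewrite typ_j lerDl sumr_ge0 // => j _; rewrite ler0n.
Qed.

(** The key being fixed, [(m, l)] determines the index. The predecessor matters: with a single
    message the bound is 0. *)
Lemma card_confusable i : (#|confusable i| <= nM.-1 * nL)%nat.
Proof.
have inj : {in confusable i &, injective (fun j : I => (j.1.1, j.2))}.
  move=> [[m k] l] [[m' k'] l']; rewrite !unfold_in /confusable /=.
  by move=> /andP[_ /eqP->] /andP[_ /eqP->] [-> ->].
rewrite -(card_in_image inj).
have -> : (nM.-1 * nL = #|[predX predC1 i.1.1 & [pred _ : 'I_nL | true]]|)%nat.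
  by rewrite cardX cardC1 !card_ord.
apply/subset_leq_card/subsetP => ml /imageP[j /andP[jm _] ->].
by rewrite !inE jm.
Qed.

Definition warden_gap (C : I -> A) :=
  \sum_z `|mean (fun i => chanZ (C i) z) - output pA chanZ z|.

Definition ideal_cost (C : I -> A) :=
  mean (fun i => \sum_s PSA (C i) s * b (xf (C i) s)).

(** The bounds on the mean state gap, warden gap and error score, added up. *)
Definition excess := cS + cZ + tS / nL%:R / cS + tZ / (nM * nK * nL)%:R / cZ
  + (nM.-1 * nL)%:R / tY
  + 2 * (\sum_s \sum_(a | tS * output pA PSA s < PSA a s) pA a * PSA a s)
  + \sum_y \sum_(a | chanY a y < tY * output pA chanY y) pA a * chanY a y
  + 2 * (\sum_z \sum_(a | tZ * output pA chanZ z < chanZ a z) pA a * chanZ a z).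

(** For each [(m, k)], soft covering by the [nL] codewords with these indices. *)
Lemma expect_state_gap :
  expect (iid pA) (fun C : {ffun I -> A} => state_gap C) <=
  tS / nL%:R / cS + cS +
  2 * (\sum_s \sum_(a | tS * output pA PSA s < PSA a s) pA a * PSA a s).
Proof.
rewrite (expect_mean (iid pA) (fun mk (C : {ffun I -> A}) =>
  \sum_s `|state_out C mk.1 mk.2 s - PS s|)).
apply: mean_le_cst => [|[m k]]; first by rewrite card_prod !card_ord muln_gt0 nM0.
have e_inj : injective (fun l : 'I_nL => (m, k, l) : I) by move=> l l' [].
have := soft_covering pA_pmf PSA_pmf e_inj _ tS0 cS0; rewrite card_ord => /(_ nL0).
apply: le_trans; rewrite le_eqVlt; apply/orP; left; apply/eqP.
by apply: eq_expect => C; apply: eq_bigr => s _; rewrite PS_out.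
Qed.

(** The key and the message are both random to the warden, so all [nM * nK * nL] codewords take part
    in the covering. *)
Lemma expect_warden_gap :
  expect (iid pA) (fun C : {ffun I -> A} => warden_gap C) <=
  tZ / (nM * nK * nL)%:R / cZ + cZ +
  2 * (\sum_z \sum_(a | tZ * output pA chanZ z < chanZ a z) pA a * chanZ a z).
Proof.
have := soft_covering pA_pmf chanZ_pmf (@inj_id I) _ tZ0 cZ0.
by rewrite !card_prod !card_ord => /(_ _); apply; rewrite !muln_gt0 nM0 nK0.
Qed.

Lemma expect_error_score :
  expect (iid pA) (fun C : {ffun I -> A} => error_score C) <=
  \sum_y \sum_(a | chanY a y < tY * output pA chanY y) pA a * chanY a y
  + (nM.-1 * nL)%:R / tY.
Proof.
rewrite (expect_mean (iid pA) (fun i (C : {ffun I -> A}) => \sum_y chanY (C i) y *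
  ((~~ typical pA chanY tY (C i) y)%:R +
     \sum_(j | confusable i j) (typical pA chanY tY (C j) y)%:R))).
apply: mean_le_cst => [|i]; first by rewrite !card_prod !card_ord !muln_gt0 nM0 nK0.
have ii : ~~ confusable i i by rewrite /confusable eqxx.
apply: le_trans (packing pA_pmf chanY_pmf ii tY0) _.
by rewrite lerD2l ler_wpM2r ?invr_ge0 ?(ltW tY0) // ler_nat card_confusable.
Qed.

Lemma expect_ideal_cost :
  expect (iid pA) (fun C : {ffun I -> A} => ideal_cost C) =
  expect pA (fun a => \sum_s PSA a s * b (xf a s)).
Proof.
rewrite (expect_mean (iid pA) (fun i (C : {ffun I -> A}) =>
  \sum_s PSA (C i) s * b (xf (C i) s))).
rewrite -[RHS](@mean_cst _ I); last by rewrite !card_prod !card_ord !muln_gt0 nM0 nK0.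
by apply: eq_mean => i; rewrite (iid_expect1 (fun a => \sum_s PSA a s * b (xf a s))).
Qed.

(* [D] is the ideal cost and [F] the sum of the gaps of a codebook which does at
   least as well as the average for [D + lam * F]. *)
Lemma random_coding :
  exists (enc : 'I_nM -> 'I_nK -> S -> X -> K) (dec : Y -> 'I_nK -> 'I_nM) (D F : K),
  [/\ forall m k s, pmf (enc m k s),
      0 <= D, 0 <= F
    & D + lam * F <= expect pA (fun a => \sum_s PSA a s * b (xf a s)) + lam * excess] /\
  [/\ \sum_m \sum_k \sum_s \sum_x \sum_y \sum_z
        (if dec y k != m then law enc m k s x y z else 0) <= F,
      \sum_m \sum_k \sum_s \sum_x \sum_y \sum_z law enc m k s x y z * b x <= D + bmax * F
    & \sum_z `|\sum_m \sum_k \sum_s \sum_x \sum_y law enc m k s x y z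
               - output pA chanZ z| <= F].
Proof.
pose G (C : I -> A) := state_gap C + warden_gap C + error_score C.
have EG : expect (iid pA) (fun C : {ffun I -> A} => G C) <= excess.
  rewrite !expectD; apply: le_trans (lerD (lerD expect_state_gap expect_warden_gap)
    expect_error_score) _; rewrite /excess; lra.
have [C C_le] := expect_attained (fun C : {ffun I -> A} => ideal_cost C + lam * G C)
  (iid_pmf I pA_pmf).
have chanY0 a y : 0 <= chanY a y by have [] := chanY_pmf a.
have PSA0 a s : 0 <= PSA a s by have [] := PSA_pmf a.
have gapS0 : 0 <= state_gap C by apply: mean_ge0 => mk; apply: sumr_ge0.
have gapZ0 : 0 <= warden_gap C by apply: sumr_ge0.
have err0 : 0 <= error_score C.
  apply: mean_ge0 => i; apply: sumr_ge0 => y _; rewrite mulr_ge0 // addr_ge0 ?ler0n //.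
  by apply: sumr_ge0 => j _; rewrite ler0n.
exists (likelihood_enc C), (decoder C), (ideal_cost C), (G C); split; split.
- exact: likelihood_enc_pmf.
- apply: mean_ge0 => i; apply: sumr_ge0 => s _; rewrite mulr_ge0 //.
  by case/andP: (b_bound (xf (C i) s)).
- by rewrite !addr_ge0.
- apply: le_trans C_le _; rewrite expectD expectZ expect_ideal_cost lerD2l.
  exact: ler_wpM2l.
(* The conditional error probability lies in [[0, 1]], so passing to the ideal law costs one state
   gap. *)
- rewrite [leLHS](_ : _ = actual C (fun m k s x =>
    \sum_y \sum_z W s x y z * (decoder C y k != m)%:R)); last first.
    rewrite -law_actual; do 4![apply: eq_bigr => ? _].
    rewrite mulr_sumr; apply: eq_bigr => y _; rewrite mulr_sumr; apply: eq_bigr => z _.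
    by case: ifP => _; rewrite ?mulr1 // !mulr0.
  apply: le_trans (actual_le_ideal C (c := 1) _) _.
    move=> m k s x; apply/andP; split.
      by do 2![apply: sumr_ge0 => ? _]; rewrite mulr_ge0 ?W_ge0 ?ler0n.
    rewrite -[leRHS](W_sumYZ s x); do 2![apply: ler_sum => ? _].
    by rewrite ler_piMr ?W_ge0 // lern1 leq_b1.
  rewrite mul1r (ideal_chanY C (fun y m k => (decoder C y k != m)%:R)).
  apply: le_trans (_ : error_score C + state_gap C <= _); last by rewrite /G; lra.
  rewrite lerD2r; apply: mean_le => i; apply: ler_sum => y _.
  by rewrite ler_wpM2l // decoder_error.
- rewrite [leLHS](_ : _ = actual C (fun _ _ _ x => b x)); last first.
    rewrite -law_actual; do 4![apply: eq_bigr => ? _]; rewrite /law.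
    under eq_bigr do rewrite -mulr_suml -mulr_sumr.
    by rewrite -mulr_suml -mulr_sumr W_sumYZ mulr1.
  apply: le_trans (actual_le_ideal C (c := bmax) _) _ => [m k s x|]; first exact: b_bound.
  by apply: lerD => //; rewrite ler_wpM2l // /G; lra.
- pose f z (m : 'I_nM) (k : 'I_nK) s x := \sum_y W s x y z.
  have f0 z m k s x : 0 <= f z m k s x by apply: sumr_ge0 => y _; apply: W_ge0.
  have f1 m k s x : \sum_z f z m k s x = 1 by rewrite exchange_big W_sumYZ.
  have wE z : \sum_m \sum_k \sum_s \sum_x \sum_y law (likelihood_enc C) m k s x y z
      = actual C (f z).
    by rewrite -law_actual; do 4![apply: eq_bigr => ? _]; rewrite -mulr_sumr.
  under eq_bigr do rewrite wE.
  apply: le_trans (_ : warden_gap C + state_gap C <= _); last by rewrite /G; lra.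
  (* Triangle inequality through the ideal law of [z]. *)
  apply: le_trans (lerD (lexx _) (actual_ideal_dist C f0 f1)).
  rewrite -big_split; apply: ler_sum => z _.
  by rewrite -ideal_chanZ [leRHS]addrC; apply: ler_distD.
Qed.

End RandomCodebook.
End StateChannel.

(** * Memoryless extensions *)

Section Product.
Variable K : realFieldType.
Implicit Types (U S X Y Z T : finType).

Definition chanprod n U T (V : U -> T -> K) (u : {ffun 'I_n -> U}) (t : {ffun 'I_n -> T}) :=
  \prod_i V (u i) (t i).

Definition lawprod n S X Y Z (W : S -> X -> Y -> Z -> K) (s : {ffun 'I_n -> S})
    (x : {ffun 'I_n -> X}) (y : {ffun 'I_n -> Y}) (z : {ffun 'I_n -> Z}) :=
  \prod_i W (s i) (x i) (y i) (z i).

Definition mapprod n U S X (f : U -> S -> X) (u : {ffun 'I_n -> U}) (s : {ffun 'I_n -> S}) :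
  {ffun 'I_n -> X} := [ffun i => f (u i) (s i)].

Lemma chanprod_pmf n U T (V : U -> T -> K) (u : {ffun 'I_n -> U}) :
  (forall u, pmf (V u)) -> pmf (chanprod V u).
Proof.
move=> V_pmf; split=> [t|]; first by apply: prodr_ge0 => i _; have [] := V_pmf (u i).
rewrite (sum_ffun_prod (fun i => V (u i))) big1 // => i _.
by have [] := V_pmf (u i).
Qed.

Lemma lawprod_pmf n S X Y Z (W : S -> X -> Y -> Z -> K) (s : {ffun 'I_n -> S}) x :
  (forall s x, pmf (fun yz : Y * Z => W s x yz.1 yz.2)) ->
  pmf (fun yz : {ffun 'I_n -> Y} * {ffun 'I_n -> Z} => lawprod W s x yz.1 yz.2).
Proof.
move=> W_pmf; split=> [[y z]|].
  by apply: prodr_ge0 => i _; apply: W_ge0.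
rewrite -(pair_bigA _ (fun y z => lawprod W s x y z)) /=.
under eq_bigr => y _ do rewrite (sum_ffun_prod (fun i => W (s i) (x i) (y i))).
rewrite (sum_ffun_prod (fun i y => \sum_z W (s i) (x i) y z)) big1 // => i _.
exact: W_sumYZ.
Qed.

(** Inducing a channel commutes with taking independent uses, by exchange of sum and product; this
    carries the single-use results over to blocks. *)
Lemma chanY_prod n U S X Y Z (PSU : U -> S -> K) (f : U -> S -> X)
    (W : S -> X -> Y -> Z -> K) (u : {ffun 'I_n -> U}) y :
  chanY (chanprod PSU) (mapprod f) (lawprod W) u y = chanprod (chanY PSU f W) u y.
Proof.
rewrite /chanY /chanprod -(sum_ffun_prod (fun i s => PSU (u i) s *
  \sum_z W s (f (u i) s) (y i) z)); apply: eq_bigr => s _.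
rewrite big_split; congr (_ * _).
rewrite -(sum_ffun_prod (fun i => W (s i) (f (u i) (s i)) (y i))).
by apply: eq_bigr => z _; apply: eq_bigr => i _; rewrite ffunE.
Qed.

Lemma chanZ_prod n U S X Y Z (PSU : U -> S -> K) (f : U -> S -> X)
    (W : S -> X -> Y -> Z -> K) (u : {ffun 'I_n -> U}) z :
  chanZ (chanprod PSU) (mapprod f) (lawprod W) u z = chanprod (chanZ PSU f W) u z.
Proof.
rewrite /chanZ /chanprod -(sum_ffun_prod (fun i s => PSU (u i) s *
  \sum_y W s (f (u i) s) y (z i))); apply: eq_bigr => s _.
rewrite big_split; congr (_ * _).
rewrite -(sum_ffun_prod (fun i y => W (s i) (f (u i) (s i)) y (z i))).
by apply: eq_bigr => y _; apply: eq_bigr => i _; rewrite ffunE.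
Qed.

Lemma output_prod n U T (p : U -> K) (V : U -> T -> K) (t : {ffun 'I_n -> T}) :
  output (iid p) (chanprod V) t = \prod_i output p V (t i).
Proof.
rewrite -(sum_ffun_prod (fun i u => p u * V u (t i))).
by apply: eq_bigr => u _; rewrite -big_split.
Qed.

Lemma sum_iid_chanprod n U T (p : U -> K) (V w : U -> T -> K) :
  \sum_(t : {ffun 'I_n -> T}) \sum_(u : {ffun 'I_n -> U})
     iid p u * chanprod V u t * \prod_i w (u i) (t i) =
  (\sum_t \sum_u p u * V u t * w u t) ^+ n.
Proof.
under eq_bigr => t _.
  under eq_bigr do rewrite -!big_split.
  rewrite (sum_ffun_prod (fun i u => p u * V u (t i) * w u (t i))).
  over.
by rewrite (sum_ffun_prod (fun i t => \sum_u p u * V u t * w u t)) prodr_const card_ord.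
Qed.

(** Markov's inequality with a product weight, whose mean factorises. The weight has to reach 1 only
    at pairs of positive mass, as the others contribute nothing. *)
Lemma tail_prod n U T (p : U -> K) (V w : U -> T -> K)
    (E : pred ({ffun 'I_n -> U} * {ffun 'I_n -> T})) :
  (forall u, 0 <= p u) -> (forall u t, 0 <= V u t) -> (forall u t, 0 <= w u t) ->
  (forall u t, E (u, t) -> (forall i, 0 < p (u i) * V (u i) (t i)) ->
    1 <= \prod_i w (u i) (t i)) ->
  \sum_t \sum_(u | E (u, t)) iid p u * chanprod V u t <=
  (\sum_t \sum_u p u * V u t * w u t) ^+ n.
Proof.
move=> p0 V0 w0 Ew; rewrite -sum_iid_chanprod; apply: ler_sum => t _.
rewrite [leLHS]big_mkcond; apply: ler_sum => u _.
have pV0 : 0 <= iid p u * chanprod V u t.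
  by rewrite mulr_ge0 // prodr_ge0 // => i _.
case: ifP => [Eut|_]; last by rewrite mulr_ge0 // prodr_ge0.
have [pVi|/forallPn[i]] := boolP [forall i, 0 < p (u i) * V (u i) (t i)].
  by rewrite ler_peMr // Ew //; apply/forallP.
rewrite lt_def mulr_ge0 // andbT negbK => pVi.
suff -> : iid p u * chanprod V u t = 0 by rewrite mul0r.
by rewrite -big_split (bigD1 i) //= (eqP pVi) mul0r.
Qed.

(** Each coordinate of the codeword and state has the single-letter law, so the average cost has
    exactly the single-letter mean. *)
Lemma expect_iid_avg n U S X (p : U -> K) (PSU : U -> S -> K) (f : U -> S -> X) (b : X -> K) :
  pmf p -> (forall u, pmf (PSU u)) -> (0 < n)%nat ->
  expect (@iid _ 'I_n _ p) (fun u => \sum_s chanprod PSU u s *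
     (n%:R^-1 * \sum_i b (mapprod f u s i))) =
  expect p (fun u => \sum_s PSU u s * b (f u s)).
Proof.
move=> p_pmf PSU_pmf n0.
rewrite (@eq_expect _ _ _ _ (fun u : {ffun 'I_n -> U} =>
  mean (fun i => \sum_s PSU (u i) s * b (f (u i) s)))).
  rewrite (expect_mean (iid p) (fun i (u : {ffun 'I_n -> U}) =>
     \sum_s PSU (u i) s * b (f (u i) s))).
  rewrite -[RHS](@mean_cst _ 'I_n) ?card_ord //; apply: eq_mean => i.
  by rewrite (iid_expect1 (fun u => \sum_s PSU u s * b (f u s))).
move=> u; rewrite /mean card_ord mulr_sumr.
under eq_bigr do rewrite mulrCA mulr_sumr mulr_sumr.
rewrite exchange_big; apply: eq_bigr => i _ /=; rewrite -mulr_sumr; congr (_ * _).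
pose F k s := PSU (u k) s * (if k == i then b (f (u k) s) else 1).
transitivity (\sum_(s : {ffun 'I_n -> S}) \prod_k F k (s k)).
  apply: eq_bigr => s _; rewrite big_split -big_mkcond /= big_pred1_eq.
  by rewrite ffunE.
rewrite sum_ffun_prod (bigD1 i) //= [X in _ * X]big1 ?mulr1.
  by apply: eq_bigr => s _; rewrite /F eqxx.
move=> k /negPf ki; rewrite -[RHS](PSU_pmf (u k)).2.
by apply: eq_bigr => s _; rewrite /F ki mulr1.
Qed.

End Product.

(** * Exponential decay of information density tails *)

(* By default the arguments of [exp] and [ln] are parsed in [R_scope]. *)
Local Arguments exp _%_ring_scope.
Local Arguments ln _%_ring_scope.

Section InformationDensity.
Local Notation ln2 := (ln (IZR 2)).
Implicit Types (U T : finType).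

Lemma expR_gt0 (x : R) : 0 < exp x.
Proof. exact/RltP/exp_pos. Qed.

Lemma expRD (x y : R) : exp (x + y) = exp x * exp y.
Proof. exact: exp_plus. Qed.

Lemma exp_sum (J : finType) (f : J -> R) : exp (\sum_j f j) = \prod_j exp (f j).
Proof.
apply: (big_morph exp) => [x y|]; [exact: exp_plus|exact: exp_0].
Qed.

Lemma ln2_gt0 : 0 < ln2 :> R.
Proof. exact/RltP/ln2_pos. Qed.

Lemma lnV (x : R) : 0 < x -> ln x^-1 = - ln x.
Proof. by move/RltP/ln_Rinv. Qed.

Lemma lnM (x y : R) : 0 < x -> 0 < y -> ln (x * y) = ln x + ln y.
Proof. by move=> /RltP x0 /RltP y0; apply: ln_mult. Qed.

Lemma expR_ln (x : R) : 0 < x -> exp (ln x) = x.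
Proof. by move/RltP/exp_ln. Qed.

Lemma expR0 : exp 0 = 1 :> R. Proof. exact: exp_0. Qed.

Lemma expR_ge1 (x : R) : (1 <= exp x) = (0 <= x).
Proof.
rewrite -expR0; apply/idP/idP; last first.
  rewrite le_eqVlt => /orP[/eqP<-|/RltP/exp_increasing/RltP/ltW//].
  exact: lexx.
by apply: contraTT; rewrite -!ltNge => /RltP/exp_increasing/RltP.
Qed.

Lemma exp_quadratic (x : R) : x <= 1 / 2 -> exp x <= 1 + x + 2 * (x * x).
Proof. by rewrite div1r => /RleP/exp_quadratic_bound/RleP. Qed.

(** With [|g| <= B] and mean [- mu], the quadratic bound on [exp] gives at most
    [1 - rho mu + 2 (rho B)^2], which is below 1 for small [rho]. *)
Lemma chernoff T (p g : T -> R) : pmf p -> expect p g < 0 ->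
  exists2 rho : R, 0 < rho & expect p (fun t => exp (rho * g t)) < 1.
Proof.
move=> p_pmf g0; pose B := 1 + \sum_t `|g t|.
have sum0 : 0 <= \sum_t `|g t| by apply: sumr_ge0.
have gB t : `|g t| <= B.
  rewrite /B (bigD1 t) //= addrCA lerDl addr_ge0 //.
  by apply: sumr_ge0.
have B1 : 1 <= B by rewrite lerDl.
set mu := - expect p g; have mu0 : 0 < mu by rewrite oppr_gt0.
have muB : mu <= B.
  rewrite /mu -mulN1r -expectZ; apply: expect_le_cst => // t.
  by rewrite mulN1r; apply: le_trans (ler_norm _) _; rewrite normrN.
have BB : 0 < B * B * 4 by rewrite !mulr_gt0 //; lra.
(* The minimiser of that bound, with value [1 - rho mu / 2]. Since [mu <= B], [rho * B <= 1 / 4],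
   within the range of the quadratic bound. *)
exists (mu / (B * B * 4)); first by rewrite divr_gt0.
set rho := _ / _.
have rhoE : rho * (B * B * 4) = mu by rewrite divfK // gt_eqF.
have rho0 : 0 < rho by rewrite divr_gt0.
have rhoB : rho * B <= 1 / 4 by nra.
apply: le_lt_trans (_ : expect p (fun t => 1 + (rho * g t + 2 * (rho * B * (rho * B)))) < 1).
  apply: expect_le p_pmf.1 _ => t; have /andP[gl gu] : - B <= g t <= B by rewrite -ler_norml.
  have rl : - (rho * B) <= rho * g t by nra.
  have ru : rho * g t <= rho * B by nra.
  apply: le_trans (_ : 1 + rho * g t + 2 * (rho * g t * (rho * g t)) <= _); last by nra.
  by apply: exp_quadratic; apply: le_trans ru (le_trans rhoB _); lra.
rewrite !expectD expectZ !expect_cst // -[expect p g]opprK -/mu.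
have : 2 * (rho * B * (rho * B)) = rho * mu / 2 by rewrite -rhoE; field.
have : 0 < rho * mu by rewrite mulr_gt0.
move=> h1 ->; lra.
Qed.

(** [ln r] has negative mean under the joint law, so some moment of order [rho] of [r] is a [c < 1].
    The product of the weights [exp (rho * ln r)] is at least 1 on [E]; [c] depends neither on [n]
    nor on [E]. *)
Lemma tail_decay U T (p : U -> R) (V r : U -> T -> R) :
  pmf p -> (forall u, pmf (V u)) ->
  (forall u t, 0 < p u * V u t -> 0 < r u t) ->
  \sum_t \sum_u p u * V u t * ln (r u t) < 0 ->
  exists2 c, 0 <= c < 1 & forall n (E : pred ({ffun 'I_n -> U} * {ffun 'I_n -> T})),
    (forall u t, E (u, t) -> (forall i, 0 < p (u i) * V (u i) (t i)) ->
       1 <= \prod_i r (u i) (t i)) ->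
    \sum_t \sum_(u | E (u, t)) iid p u * chanprod V u t <= c ^+ n.
Proof.
move=> p_pmf V_pmf r0 mean_lt0.
have p0 := p_pmf.1; have V0 u t : 0 <= V u t by have [] := V_pmf u.
pose P (tu : T * U) := p tu.2 * V tu.2 tu.1.
have P_pmf : pmf P.
  split=> [tu|]; first exact: mulr_ge0.
  rewrite -(pair_bigA _ (fun t u => p u * V u t)) exchange_big /= -p_pmf.2.
  by apply: eq_bigr => u _; rewrite -mulr_sumr (V_pmf u).2 mulr1.
have [||rho rho0 rho1] := @chernoff _ P (fun tu => ln (r tu.2 tu.1)) => //.
  by rewrite /expect -(pair_bigA _ (fun t u => p u * V u t * ln (r u t))).
move: rho1; rewrite /expect -(pair_bigA _ (fun t u => p u * V u t * exp (rho * ln (r u t)))) /=.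
set c := \sum_t _ => c1; exists c.
  by rewrite c1 andbT; do 2![apply: sumr_ge0 => ? _]; rewrite !mulr_ge0 // ltW // expR_gt0.
move=> n E Er; apply: tail_prod => // [u t|u t Eut pV]; first exact/ltW/expR_gt0.
rewrite -exp_sum expR_ge1 -mulr_sumr mulr_ge0 ?(ltW rho0) // -expR_ge1 exp_sum.
rewrite (eq_bigr (fun i => r (u i) (t i))) => [|i _]; first exact: Er.
by rewrite expR_ln // r0.
Qed.

(** Mutual information in nats. *)
Definition information U T (p : U -> R) (V : U -> T -> R) :=
  \sum_t \sum_u p u * V u t * ln (V u t / output p V t).

Section Tails.
Variables (U T : finType) (p : U -> R) (V : U -> T -> R).
Hypotheses (p_pmf : pmf p) (V_pmf : forall u, pmf (V u)).

Lemma support_gt0 u t : 0 < p u * V u t -> 0 < V u t /\ 0 < output p V t.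
Proof.
have p0 := p_pmf.1; have V0 v : 0 <= V v t by have [] := V_pmf v.
move=> puV; split.
  by rewrite lt_def V0 andbT; apply: contraTneq puV => ->; rewrite mulr0 ltxx.
apply: lt_le_trans puV _; rewrite /output /expect (bigD1 u) //= lerDl.
by apply: sumr_ge0 => v _; rewrite mulr_ge0.
Qed.

Lemma sum_support_ln tau : 0 < tau ->
  \sum_t \sum_u p u * V u t * ln (V u t / output p V t * tau^-1) =
  information p V - ln tau.
Proof.
move=> tau0; have p0 := p_pmf.1; have V0 u t : 0 <= V u t by have [] := V_pmf u.
transitivity (\sum_t \sum_u (p u * V u t * ln (V u t / output p V t) - p u * V u t * ln tau)).
  apply: eq_bigr => t _; apply: eq_bigr => u _.
  have [puV|] := ltP 0 (p u * V u t).
    have [Vp op] := support_gt0 puV.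
    by rewrite lnM ?lnV ?invr_gt0 ?divr_gt0 // mulrDr mulrN.
  rewrite le_eqVlt ltNge mulr_ge0 // orbF => /eqP->.
  by rewrite !mul0r subr0.
under eq_bigr do rewrite sumrB; rewrite sumrB; congr (_ - _).
under eq_bigr do rewrite -mulr_suml; rewrite -mulr_suml exchange_big /=.
rewrite (eq_bigr p) => [|u _]; first by rewrite p_pmf.2 mul1r.
by rewrite -mulr_sumr (V_pmf u).2 mulr1.
Qed.

(** Gibbs' inequality: [ln x <= x - 1] at [x = output / V] on the support. *)
Lemma information_ge0 : 0 <= information p V.
Proof.
have p0 := p_pmf.1; have V0 u t : 0 <= V u t by have [] := V_pmf u.
have out0 t : 0 <= output p V t by apply: expect_ge0.
apply: le_trans (_ : \sum_t \sum_u (p u * V u t - p u * output p V t) <= _).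
  under eq_bigr do rewrite sumrB -mulr_suml p_pmf.2 mul1r.
  by rewrite big1 // => t _; rewrite subrr.
do 2![apply: ler_sum => ? _]; set u := (X in p X); set t := (X in V _ X).
have [puV|] := ltP 0 (p u * V u t).
  have [Vp op] := support_gt0 puV.
  have /RltP/ln_le_sub1/RleP : 0 < output p V t / V u t by rewrite divr_gt0.
  rewrite -invf_div lnV ?divr_gt0 // => ln_le.
  have pu : 0 <= p u * V u t by rewrite ltW.
  have := ler_wpM2l pu ln_le; rewrite RminusE mulrBr mulr1 invf_div.
  have -> : p u * V u t * (output p V t / V u t) = p u * output p V t.
    by field; rewrite gt_eqF.
  by rewrite mulrN; lra.
rewrite le_eqVlt ltNge mulr_ge0 // orbF => /eqP->.
by rewrite mul0r sub0r oppr_le0 mulr_ge0.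
Qed.

(** Take for [r] the density ratio divided by [tau]: its logarithm has mean
    [information - ln tau]. *)
Lemma upper_tail tau : 0 < tau -> information p V < ln tau ->
  exists2 c, 0 <= c < 1 & forall n,
    \sum_(t : {ffun 'I_n -> T})
      \sum_(u | tau ^+ n * output (iid p) (chanprod V) t < chanprod V u t)
        iid p u * chanprod V u t <= c ^+ n.
Proof.
move=> tau0 info_lt; pose r u t := V u t / output p V t * tau^-1.
have [||c c01 tail] := @tail_decay _ _ p V r p_pmf V_pmf.
- by move=> u t /support_gt0[Vp op]; rewrite mulr_gt0 ?invr_gt0 ?divr_gt0.
- by rewrite sum_support_ln // subr_lt0.
exists c => // n; apply: (tail n (fun ut =>
  tau ^+ n * output (iid p) (chanprod V) ut.2 < chanprod V ut.1 ut.2)) => u t /= lt_ut pV.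
have out0 : 0 < \prod_i output p V (t i).
  by apply: prodr_gt0 => i _; have [] := support_gt0 (pV i).
rewrite /r big_split prodf_div prodr_const card_ord exprVn /=.
rewrite -mulrA -invfM ler_pdivlMr ?mulr_gt0 ?exprn_gt0 // mul1r mulrC.
by rewrite -output_prod; apply: ltW.
Qed.

(** The same with the reciprocal ratio, which reverses both the event and the sign of the mean. *)
Lemma lower_tail tau : 0 < tau -> ln tau < information p V ->
  exists2 c, 0 <= c < 1 & forall n,
    \sum_(t : {ffun 'I_n -> T})
      \sum_(u | chanprod V u t < tau ^+ n * output (iid p) (chanprod V) t)
        iid p u * chanprod V u t <= c ^+ n.
Proof.
move=> tau0 info_gt; pose r u t := (V u t / output p V t * tau^-1)^-1.
have p0 := p_pmf.1; have V0 u t : 0 <= V u t by have [] := V_pmf u.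
have r0 u t : 0 < p u * V u t -> 0 < r u t.
  by move=> /support_gt0[Vp op]; rewrite /r invr_gt0 mulr_gt0 ?invr_gt0 ?divr_gt0.
have [|c c01 tail] := @tail_decay _ _ p V r p_pmf V_pmf r0.
  suff -> : \sum_t \sum_u p u * V u t * ln (r u t) = - (information p V - ln tau).
    by rewrite opprB subr_lt0.
  rewrite -sum_support_ln // -sumrN; apply: eq_bigr => t _.
  rewrite -sumrN; apply: eq_bigr => u _.
  have [puV|] := ltP 0 (p u * V u t).
    by rewrite /r lnV ?mulrN // -invr_gt0 r0.
  rewrite le_eqVlt ltNge mulr_ge0 // orbF => /eqP->.
  by rewrite !mul0r oppr0.
exists c => // n; apply: (tail n (fun ut =>
  chanprod V ut.1 ut.2 < tau ^+ n * output (iid p) (chanprod V) ut.2)) => u t /= lt_ut pV.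
have out0 : 0 < \prod_i output p V (t i).
  by apply: prodr_gt0 => i _; have [] := support_gt0 (pV i).
have V'0 : 0 < \prod_i V (u i) (t i).
  by apply: prodr_gt0 => i _; have [] := support_gt0 (pV i).
rewrite /r prodfV big_split prodf_div prodr_const card_ord exprVn /=.
rewrite -mulrA -invfM invf_div ler_pdivlMr // mul1r mulrC.
by rewrite -output_prod; apply: ltW.
Qed.

(** The factor [p u] cancels in the density ratio; [ln2] converts nats to bits. *)
Lemma MI_information (P : U -> T -> R) : (forall u t, P u t = p u * V u t) ->
  MI P = information p V / ln2.
Proof.
move=> PE; have p0 := p_pmf.1; have V0 u t : 0 <= V u t by have [] := V_pmf u.
have PU u : \sum_t P u t = p u.
  by under eq_bigr do rewrite PE; rewrite -mulr_sumr (V_pmf u).2 mulr1.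
have PT t : \sum_u P u t = output p V t by apply: eq_bigr => u _; rewrite PE.
rewrite [LHS](_ : _ = \sum_u \sum_t plogq (P u t) ((\sum_t' P u t') * \sum_u' P u' t)) //.
rewrite exchange_big /information mulr_suml; apply: eq_bigr => t _.
rewrite mulr_suml; apply: eq_bigr => u _; rewrite PU PT PE.
rewrite /plogq /log2; case: RIneq.Req_EM_T => [pV0|] /=; first by rewrite pV0 !mul0r.
move=> /eqP pVN0; have puV : 0 < p u * V u t by rewrite lt_def pVN0 mulr_ge0.
have pu : p u != 0 by apply: contraNneq pVN0 => ->; rewrite mul0r.
rewrite RmultE !RdivE mulrA; congr (_ * ln _ / _).
by rewrite RmultE -mulf_div divff // mul1r.
Qed.

End Tails.

(** Termwise: the lower bounds sum to 0, and the upper ones give the L1 distance times a factor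
    linear in [c], a bound on [- ln Q]. *)
Lemma KL_bounds T (P Q : T -> R) (c : R) : pmf P -> pmf Q -> (forall t, 0 < Q t) ->
  0 <= c -> (forall t, - ln (Q t) <= c) ->
  0 <= KL P Q <= (1 + c) / ln2 * \sum_t `|P t - Q t|.
Proof.
move=> [P0 P1] [_ Q1] Q0 c0 Qc.
rewrite [KL P Q](_ : _ = \sum_t plogq (P t) (Q t)) //.
have P_le1 t : P t <= 1 by rewrite -P1 (bigD1 t) //= lerDl sumr_ge0.
apply/andP; split.
  apply: le_trans (_ : \sum_t (P t - Q t) / ln2 <= _).
    by rewrite -mulr_suml sumrB P1 Q1 subrr mul0r.
  by apply: ler_sum => t _; apply/RleP; rewrite -RdivE; apply: plogq_ge; apply/RleP || apply/RltP.
rewrite mulr_sumr; apply: ler_sum => t _; rewrite -RabsE -RdivE; apply/RleP.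
by apply: plogq_le; [split; apply/RleP|apply/RltP|apply/RleP|apply/RleP].
Qed.

End InformationDensity.

(** * Block codes with exponentially small gaps *)

Section CodingExponent.
Local Notation ln2 := (ln (IZR 2)).
Variables U S X Y Z : finType.
Variables (p : U -> R) (PSU : U -> S -> R) (f : U -> S -> X).
Variables (W : S -> X -> Y -> Z -> R) (PS : S -> R) (b : X -> R).
Hypotheses (p_pmf : pmf p) (PSU_pmf : forall u, pmf (PSU u)).
Hypothesis W_pmf : forall s x, pmf (fun yz : Y * Z => W s x yz.1 yz.2).
Hypothesis PS_out : forall s, output p PSU s = PS s.
Hypothesis b0 : forall x, 0 <= b x.
Variables RM RK RL : R.
Hypotheses (RM0 : 0 <= RM) (RK0 : 0 <= RK) (RL0 : 0 <= RL).
(** Rates are in bits and informations in nats, hence [ln2]. In the alternative [RM = 0] there is a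
    single message and nothing to decode. *)
Hypothesis rate_S : information p PSU < RL * ln2.
Hypothesis rate_Z : information p (chanZ PSU f W) < (RM + RK + RL) * ln2.
Hypothesis rate_Y : RM = 0 \/ (RM + RL) * ln2 < information p (chanY PSU f W).

Lemma set_size_gt0 n r : (0 < set_size n r)%nat.
Proof. by rewrite /set_size expn_gt0. Qed.

Lemma set_size_expR_bounds n r : 0 <= r ->
  exp (r * ln2) ^+ n <= (set_size n r)%:R <= 2 * exp (r * ln2) ^+ n.
Proof.
move=> /RleP r0; have [lo hi] := set_size_bounds n r0.
by rewrite -RpowE -(INRE (set_size n r)); apply/andP; split; apply/RleP.
Qed.

Lemma set_size0 n : set_size n (0 : R) = 1%nat.
Proof.
apply/eqP; rewrite eqn_leq set_size_gt0 andbT.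
have [_] := ceil_nat_bounds (Rle_refl 0); rewrite /set_size RmultE mulr0.
rewrite Rplus_0_l; move=> /(INR_lt _ 1)/ssrnat.ltP; rewrite ltnS leqn0 => /eqP->.
by [].
Qed.

(* With threshold [t ^ n] and codebook size [exp r ^ n], both terms of
   [soft_covering] at [c = e ^ n] equal [e ^ n]. *)
Lemma covering_threshold (i r : R) : i < r ->
  exists e t, [/\ 0 < e, e < 1, 0 < t, i < ln t & t = exp r * (e * e)].
Proof.
(* Then [ln t = r - 2 d] is the midpoint of [i] and [r]. *)
move=> ir; pose d := (r - i) / 4; have d0 : 0 < d by rewrite /d; lra.
exists (exp (- d)), (exp (r - d - d)).
have eE : exp r * (exp (- d) * exp (- d)) = exp (r - d - d).
  by rewrite -!expRD; congr exp; ring.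
split=> //; try exact: expR_gt0.
  by rewrite -expR0; apply/RltP/exp_increasing/RltP; rewrite oppr_lt0.
by rewrite ln_exp /d; lra.
Qed.

Lemma decoding_threshold : exists e t c, [/\ 0 <= e < 1, 0 < t, 0 <= c < 1,
  forall n, ((set_size n RM).-1 * set_size n RL)%:R / t ^+ n <= 4 * e ^+ n
  & forall n, \sum_(y : {ffun 'I_n -> Y})
      \sum_(u | chanprod (chanY PSU f W) u y <
                t ^+ n * output (iid p) (chanprod (chanY PSU f W)) y)
        iid p u * chanprod (chanY PSU f W) u y <= c ^+ n].
Proof.
have Y_pmf := chanY_pmf f PSU_pmf W_pmf.
have tail t : 0 < t -> ln t < information p (chanY PSU f W) -> _ :=
  @lower_tail _ _ p _ p_pmf Y_pmf t.
case: rate_Y => [RM_0|rate].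
  (* A single message has no competitor, so any threshold below the information will do, with
     [e = 0]. *)
  pose i := information p (chanY PSU f W) - 1.
  have [||c c01 cP] := tail (exp i); [exact: expR_gt0|by rewrite ln_exp /i; lra|].
  exists 0, (exp i), c; split=> //; [by rewrite lexx ltr01|exact: expR_gt0|].
  move=> n; rewrite RM_0 set_size0 mul0n mul0r mulr_ge0 // exprn_ge0 //.
set r := (RM + RL) * ln2 in rate *; set i := information _ _ in rate *.
(* The midpoint of rate and information leaves room both for the tail and for the competitors, whose
   share is [exp (r - t) ^+ n]; the factor 4 comes from rounding two set sizes. *)
pose t := (r + i) / 2.
have [||c c01 cP] := tail (exp t); [exact: expR_gt0|by rewrite ln_exp -/i /t; lra|].
exists (exp (r - t)), (exp t), c; split=> //; [|exact: expR_gt0|].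
  rewrite ltW ?expR_gt0 // -expR0; apply/RltP/exp_increasing/RltP.
  by rewrite /t; lra.
move=> n; have /andP[_ M_le] := set_size_expR_bounds n RM0.
have /andP[_ L_le] := set_size_expR_bounds n RL0.
rewrite ler_pdivrMr ?exprn_gt0 ?expR_gt0 // -mulrA -exprMn -expRD.
have -> : r - t + t = RM * ln2 + RL * ln2 by rewrite /r; ring.
rewrite expRD exprMn natrM.
apply: le_trans (_ : _ <= (2 * exp (RM * ln2) ^+ n) * (2 * exp (RL * ln2) ^+ n)) _.
  apply: ler_pM => //; apply: le_trans M_le.
  by rewrite ler_nat leq_pred.
by rewrite le_eqVlt; apply/orP; left; apply/eqP; ring.
Qed.

Definition mean_cost n (x : {ffun 'I_n -> X}) := n%:R^-1 * \sum_i (b (x i) : R).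

Lemma mean_cost_bound n (x : {ffun 'I_n -> X}) : 0 <= mean_cost x <= \sum_a b a.
Proof.
have sb0 : 0 <= \sum_a b a by apply: sumr_ge0.
have -> : mean_cost x = mean (fun i => b (x i)) by rewrite /mean card_ord.
rewrite mean_ge0 //; case: n x => [|n] x.
  by rewrite /mean big_ord0 mulr0.
apply: mean_le_cst => [|i]; first by rewrite card_ord.
by rewrite (bigD1 (x i)) //= lerDl sumr_ge0.
Qed.

(** An equality for [n > 0]; for the empty block the left side is 0. *)
Lemma expect_mean_cost n :
  expect (iid p) (fun u : {ffun 'I_n -> U} =>
     \sum_s chanprod PSU u s * mean_cost (mapprod f u s)) <=
  expect p (fun u => \sum_s PSU u s * b (f u s)).
Proof.
case: n => [|n]; last by rewrite expect_iid_avg.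
apply: le_trans (_ : 0 <= _).
  rewrite /expect big1 // => u _; rewrite big1 ?mulr0 // => s _.
  by rewrite /mean_cost big_ord0 !mulr0.
apply: expect_ge0 => [|u]; first exact: p_pmf.1.
by apply: sumr_ge0 => s _; rewrite mulr_ge0 // (PSU_pmf u).1.
Qed.

Definition law_n n (nM nK : nat)
    (enc : 'I_nM -> 'I_nK -> {ffun 'I_n -> S} -> {ffun 'I_n -> X} -> R) :=
  law (lawprod W) (fun s => \prod_i PS (s i)) enc.

(** Apply [random_coding] to blocks with weight [g^-n]. The mean gaps are at most [13 g^(2n)], so
    the weighted total exceeds the mean cost by at most [13 g^n], which bounds both the excess cost
    and the gaps. *)
Lemma exponential_codes : exists g c : R, [/\ 0 < g, g < 1, 0 <= c &
  forall n, exists (enc : 'I_(set_size n RM) -> 'I_(set_size n RK) ->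
      {ffun 'I_n -> S} -> {ffun 'I_n -> X} -> R)
    (dec : {ffun 'I_n -> Y} -> 'I_(set_size n RK) -> 'I_(set_size n RM)),
  [/\ forall m k s, pmf (enc m k s),
      \sum_m \sum_k \sum_s \sum_x \sum_y \sum_z
        (if dec y k != m then law_n enc m k s x y z else 0) <= c * g ^+ n,
      \sum_m \sum_k \sum_s \sum_x \sum_y \sum_z law_n enc m k s x y z * mean_cost x <=
        expect p (fun u => \sum_s PSU u s * b (f u s)) + c * g ^+ n
    & \sum_z `|\sum_m \sum_k \sum_s \sum_x \sum_y law_n enc m k s x y z
               - \prod_i output p (chanZ PSU f W) (z i)| <= c * g ^+ n]].
Proof.
have Z_pmf := chanZ_pmf f PSU_pmf W_pmf.
have [eS [tS [eS0 eS1 tS0 tS_gt tSE]]] := covering_threshold rate_S.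
have [eZ [tZ [eZ0 eZ1 tZ0 tZ_gt tZE]]] := covering_threshold rate_Z.
have [eY [tY [cY [/andP[eY0 eY1] tY0 /andP[cY0 cY1] sizeY tailY]]]] := decoding_threshold.
have [cS /andP[cS0 cS1] tailS] := upper_tail p_pmf PSU_pmf tS0 tS_gt.
have [cZ /andP[cZ0 cZ1] tailZ] := upper_tail p_pmf Z_pmf tZ0 tZ_gt.
(* A common base for all six exponential bounds. *)
pose d := Num.max (Num.max (Num.max eS eZ) (Num.max eY cY)) (Num.max cS cZ).
have d0 : 0 < d by rewrite /d !lt_max eS0.
have d1 : d < 1 by rewrite /d !gt_max eS1 eZ1 eY1 cY1 cS1 cZ1.
have le_d e n : 0 <= e -> e <= d -> e ^+ n <= d ^+ n.
  by move=> e0 ed; apply: lerXn2r; rewrite ?nnegrE // ltW.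
(* By the arithmetic-geometric mean inequality [d <= g * g], with [g] still below 1. *)
pose g := (1 + d) / 2.
have g0 : 0 < g by rewrite /g; lra.
have g1 : g < 1 by rewrite /g; lra.
have dg : d <= g * g by rewrite /g; nra.
pose bmax := \sum_a b a; have bmax0 : 0 <= bmax by apply: sumr_ge0.
pose E := expect p (fun u => \sum_s PSU u s * b (f u s)).
have E0 : 0 <= E.
  apply: expect_ge0 => [|u]; first exact: p_pmf.1.
  by apply: sumr_ge0 => s _; rewrite mulr_ge0 // (PSU_pmf u).1.
exists g, (E + 13 + bmax * (E + 13)); split => //; first by rewrite !addr_ge0 ?mulr_ge0 // addr_ge0.
move=> n.
have gn0 : 0 < g ^+ n by rewrite exprn_gt0.
have lam0 : 0 <= (g ^+ n)^-1 by rewrite invr_ge0 ltW.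
have PSn_out (s : {ffun 'I_n -> S}) : output (iid p) (chanprod PSU) s = \prod_i PS (s i).
  by rewrite output_prod; apply: eq_bigr => i _.
have [enc [dec [D [F [[enc_pmf D0 F0 DF] [err cost warden]]]]]] :=
  @random_coding _ _ _ _ _ _ (chanprod PSU) (mapprod f) (lawprod W)
   (fun u => chanprod_pmf u PSU_pmf) (fun s x => lawprod_pmf s x W_pmf)
   _ _ _ (set_size_gt0 n RM) (set_size_gt0 n RK) (set_size_gt0 n RL) _ _
   (@mean_cost n) bmax (iid_pmf _ p_pmf) PSn_out (@mean_cost_bound n)
   (tS ^+ n) (tY ^+ n) (tZ ^+ n) (eS ^+ n) (eZ ^+ n) (g ^+ n)^-1
   (exprn_ge0 n (ltW tS0)) (exprn_gt0 n tY0) (exprn_ge0 n (ltW tZ0))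
   (exprn_gt0 n eS0) (exprn_gt0 n eZ0) lam0 bmax0.
have chanYE : chanY (chanprod PSU) (mapprod f) (lawprod W) = chanprod (n := n) (chanY PSU f W).
  by apply: functional_extensionality => u; apply: functional_extensionality => y;
     exact: chanY_prod.
have chanZE : chanZ (chanprod PSU) (mapprod f) (lawprod W) = chanprod (n := n) (chanZ PSU f W).
  by apply: functional_extensionality => u; apply: functional_extensionality => y;
     exact: chanZ_prod.
have coverS : tS ^+ n / (set_size n RL)%:R / eS ^+ n <= eS ^+ n.
  have /andP[L_ge _] := set_size_expR_bounds n RL0.
  rewrite ler_pdivrMr ?exprn_gt0 // ler_pdivrMr ?ltr0n ?set_size_gt0 //.
  rewrite tSE exprMn exprMn mulrC ler_wpM2l // mulr_ge0 ?exprn_ge0 // ltW //.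
have coverZ : tZ ^+ n / (set_size n RM * set_size n RK * set_size n RL)%:R / eZ ^+ n <= eZ ^+ n.
  have /andP[L_ge _] := set_size_expR_bounds n RL0.
  have /andP[M_ge _] := set_size_expR_bounds n RM0.
  have /andP[K_ge _] := set_size_expR_bounds n RK0.
  have ex0 r : 0 <= exp r ^+ n by rewrite exprn_ge0 // ltW // expR_gt0.
  rewrite ler_pdivrMr ?exprn_gt0 // ler_pdivrMr ?ltr0n ?muln_gt0 ?set_size_gt0 //.
  rewrite tZE exprMn exprMn mulrC ler_wpM2l ?mulr_ge0 ?exprn_ge0 ?(ltW eZ0) //.
  by rewrite !mulrDl !expRD !exprMn !natrM !ler_pM ?mulr_ge0.
(* The count 13 is 4 for the two coverings, 4 for the competitors, and 2 + 1 + 2 for the tails of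
   [S], [Y] and [Z]. *)
have excess_le : excess (chanprod (n := n) PSU) (mapprod f) (lawprod W)
   (set_size n RM) (set_size n RK) (set_size n RL) (iid p)
   (tS ^+ n) (tY ^+ n) (tZ ^+ n) (eS ^+ n) (eZ ^+ n) <= 13 * (g ^+ n * g ^+ n).
  apply: (@le_trans _ _ (13 * d ^+ n)); last first.
    rewrite -exprMn ler_wpM2l //; apply: lerXn2r => //; rewrite nnegrE.
      exact: ltW.
    by rewrite mulr_ge0 // ltW.
  rewrite /excess chanYE chanZE.
  have := tailS n; have := tailY n; have := tailZ n; have := sizeY n.
  have dS : eS ^+ n <= d ^+ n by apply: le_d; [exact: ltW|rewrite /d !le_max lexx].
  have dZ : eZ ^+ n <= d ^+ n by apply: le_d; [exact: ltW|rewrite /d !le_max lexx !orbT].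
  have dY : eY ^+ n <= d ^+ n by apply: le_d; rewrite // /d !le_max lexx ?orbT.
  have dcS : cS ^+ n <= d ^+ n by apply: le_d; rewrite // /d !le_max lexx ?orbT.
  have dcZ : cZ ^+ n <= d ^+ n by apply: le_d; rewrite // /d !le_max lexx ?orbT.
  have dcY : cY ^+ n <= d ^+ n by apply: le_d; rewrite // /d !le_max lexx ?orbT.
  lra.
have DF_le : D + (g ^+ n)^-1 * F <= E + 13 * g ^+ n.
  apply: (le_trans DF); apply: lerD (expect_mean_cost n) _.
  by rewrite ler_pdivrMl // [leRHS]mulrCA.
(* Drop [D >= 0] from the weighted bound and multiply by [g ^+ n <= 1]. *)
have F_le : F <= (E + 13) * g ^+ n.
  have gn1 : g ^+ n <= 1 by rewrite exprn_ile1 // ltW.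
  rewrite mulrC -ler_pdivrMl //; lra.
have lamF0 : 0 <= (g ^+ n)^-1 * F by rewrite mulr_ge0.
have bF : bmax * F <= bmax * ((E + 13) * g ^+ n) by apply: ler_wpM2l.
have E13g : 0 <= E * g ^+ n by rewrite mulr_ge0 // ltW.
have bg : 0 <= bmax * ((E + 13) * g ^+ n) by rewrite mulr_ge0 // mulr_ge0 ?ltW //; lra.
have cE : (E + 13 + bmax * (E + 13)) * g ^+ n =
  (E + 13) * g ^+ n + bmax * ((E + 13) * g ^+ n) by ring.
exists enc, dec; rewrite cE; split=> //.
- by apply: le_trans err _; lra.
- by apply: le_trans cost _; rewrite -/E; lra.
- apply: le_trans (_ : F <= _); last by lra.
  apply: le_trans warden; rewrite le_eqVlt; apply/orP; left; apply/eqP.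
  by apply: eq_bigr => z _; rewrite chanZE output_prod.
Qed.

End CodingExponent.

(** * The covert coding theorem *)

Section Bayes.
Variables (K : realFieldType) (S U : finType) (PS : S -> K) (PUS : S -> U -> K).
Hypotheses (PS_pmf : pmf PS) (PUS_pmf : forall s, pmf (PUS s)).

(* [P_{S|U}]; for a symbol [u] of probability zero any law would do. *)
Definition posterior u s :=
  if output PS PUS u == 0 then PS s else PS s * PUS s u / output PS PUS u.

Lemma output_pmf : pmf (output PS PUS).
Proof.
split=> [u|].
  by apply: expect_ge0 PS_pmf.1 _ => s; have [] := PUS_pmf s.
rewrite -expect_sum -(expect_cst 1 PS_pmf); apply: eq_expect => s.
exact: (PUS_pmf s).2.
Qed.

Lemma state_input_ge0 s u : 0 <= PS s * PUS s u.
Proof. by rewrite mulr_ge0 ?PS_pmf.1 ?(PUS_pmf s).1. Qed.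

Lemma posterior_pmf u : pmf (posterior u).
Proof.
rewrite /posterior; case: eqP => [//|/eqP out0]; split=> [s|].
  by rewrite divr_ge0 ?state_input_ge0 // output_pmf.1.
by rewrite -mulr_suml divff.
Qed.

(** At a symbol [u] of probability zero every joint mass [PS s * PUS s u] vanishes, so the default
    law does no harm. *)
Lemma posteriorE u s : output PS PUS u * posterior u s = PS s * PUS s u.
Proof.
rewrite /posterior; case: eqP => [out0|/eqP out0]; last by rewrite mulrCA divff ?mulr1.
rewrite out0 mul0r; move/eqP: out0; rewrite /output /expect psumr_eq0 => [|s' _].
  by move=> /allP/(_ s (mem_index_enum _))/eqP.
exact: state_input_ge0.
Qed.

Lemma output_posterior s : output (output PS PUS) posterior s = PS s.
Proof.
rewrite /output /expect (eq_bigr (fun u => PS s * PUS s u)) => [|u _].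
  by rewrite -mulr_sumr (PUS_pmf s).2 mulr1.
exact: posteriorE.
Qed.

End Bayes.

(** * The single-letter quantities through the [U]-marginal and the posterior *)

Section SingleLetter.
Variables (X S Y Z U : finType) (PS : S -> R) (W : S -> X -> Y -> Z -> R) (b : X -> R).
Variables (PUS : S -> U -> R) (xf : U -> S -> X).
Hypotheses (PS_pmf : pmf PS) (PUS_pmf : forall s, pmf (PUS s)).
Hypothesis W_pmf : forall s x, pmf (fun yz : Y * Z => W s x yz.1 yz.2).
Local Notation p := (output PS PUS).
Local Notation PSU := (posterior PS PUS).

(** The indicator collapses the sum over [x], and Bayes' rule turns the factorisation around. *)
Lemma sum_jP (F : S -> X -> R) u s :
  \sum_x PS s * PUS s u * (if x == xf u s then 1 else 0) * F s x =
  p u * PSU u s * F s (xf u s).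
Proof.
rewrite (bigD1 (xf u s)) //= eqxx mulr1 posteriorE // big1 ?addr0 // => x /negPf->.
by rewrite mulr0 mul0r.
Qed.

Lemma P_USE u s : P_US PS W PUS xf u s = p u * PSU u s.
Proof.
rewrite -[RHS]mulr1 -(W_sumYZ W_pmf s (xf u s)).
rewrite -(sum_jP (fun s x => \sum_y \sum_z W s x y z)).
apply: eq_bigr => x _; rewrite mulr_sumr; apply: eq_bigr => y _.
by rewrite mulr_sumr.
Qed.

Lemma P_UYE u y : P_UY PS W PUS xf u y = p u * chanY PSU xf W u y.
Proof.
rewrite mulr_sumr; apply: eq_bigr => s _; rewrite mulrA.
rewrite -(sum_jP (fun s x => \sum_z W s x y z)); apply: eq_bigr => x _.
by rewrite mulr_sumr.
Qed.

Lemma P_UZE u z : P_UZ PS W PUS xf u z = p u * chanZ PSU xf W u z.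
Proof.
rewrite mulr_sumr; apply: eq_bigr => s _; rewrite mulrA.
rewrite -(sum_jP (fun s x => \sum_y W s x y z)); apply: eq_bigr => x _.
by rewrite mulr_sumr.
Qed.

Lemma P_ZE z : P_Z PS W PUS xf z = output p (chanZ PSU xf W) z.
Proof.
rewrite [LHS]exchange_big; apply: eq_bigr => u _.
exact: P_UZE.
Qed.

Lemma E_bXE : E_bX PS W b PUS xf = expect p (fun u => \sum_s PSU u s * b (xf u s)).
Proof.
rewrite [LHS]exchange_big; apply: eq_bigr => u _.
rewrite mulr_sumr; apply: eq_bigr => s _; rewrite mulrA.
rewrite -(sum_jP (fun _ x => b x)); apply: eq_bigr => x _.
have bE : b x = \sum_y \sum_z W s x y z * b x.
  rewrite -[LHS]mul1r -(W_sumYZ W_pmf s x) mulr_suml; apply: eq_bigr => y _.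
  by rewrite mulr_suml.
rewrite [in RHS]bE mulr_sumr; apply: eq_bigr => y _; rewrite mulr_sumr.
by apply: eq_bigr => z _; rewrite [RHS]mulrA.
Qed.

End SingleLetter.

Lemma is_pmfP (T : finType) (q : T -> R) : is_pmf q -> pmf q.
Proof. by case=> q0 q1; split=> // t; apply/RleP. Qed.

Lemma squeeze_cv0 (u v : nat -> R) :
  (forall n, 0 <= u n <= v n) -> Un_cv v (IZR 0) -> Un_cv u (IZR 0).
Proof.
move=> uv v_cv eps /v_cv[N vN]; exists N => n /vN; have /andP[u0 u_le] := uv n.
rewrite /R_dist /Rdist => /RltP v_lt; apply/RltP; apply: le_lt_trans v_lt.
rewrite !Rminus_0_r !RabsE !ger0_norm //; exact: le_trans u_le.
Qed.

Lemma linear_exponential_cv0 (a c g : R) : 0 < g -> g < 1 ->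
  Un_cv (fun n => (a + c * n%:R) * g ^+ n) (IZR 0).
Proof.
move=> /RltP g0 /RltP g1 eps /(linear_mul_pow_cv a c (conj g0 g1))[N cvN].
by exists N => n /cvN; rewrite RpowE INRE.
Qed.

(** Each factor contributes at most the sum of [- ln (q a)] over the whole alphabet, a crude bound
    on the largest term. *)
Lemma ln_prod_lower (T : finType) (q : T -> R) n (t : {ffun 'I_n -> T}) :
  (forall a, 0 < q a) -> (forall a, q a <= 1) ->
  - ln (\prod_i q (t i)) <= n%:R * \sum_a - ln (q a).
Proof.
move=> q0 q1.
have lnq a : 0 <= - ln (q a).
  rewrite -lnV // -expR_ge1 expR_ln ?invr_gt0 // invf_ge1 //.
have -> : \prod_i q (t i) = exp (\sum_i ln (q (t i))).
  by rewrite exp_sum; apply: eq_bigr => i _; rewrite expR_ln.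
rewrite ln_exp -sumrN mulr_natl -[X in _ *+ X](card_ord n) -sumr_const.
apply: ler_sum => i _; rewrite (bigD1 (t i)) //= lerDl.
by apply: sumr_ge0.
Qed.

(** * From exponentially good codes to achievable rates *)

Section Achievability.
Local Notation ln2 := (ln (IZR 2)).
Variables (X S Y Z U : finType) (PS : S -> R) (W : S -> X -> Y -> Z -> R).
Variables (x0 : X) (b : X -> R) (PUS : S -> U -> R) (xf : U -> S -> X).
Hypotheses (PS_pmf : pmf PS) (PUS_pmf : forall s, pmf (PUS s)).
Hypothesis W_pmf : forall s x, pmf (fun yz : Y * Z => W s x yz.1 yz.2).
Hypothesis Q0_gt0 : forall z, 0 < Q0 PS W x0 z.
Hypothesis b0 : forall x, 0 <= b x.
Hypothesis P_Z_Q0 : forall z, P_Z PS W PUS xf z = Q0 PS W x0 z.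

Local Notation p := (output PS PUS).
Local Notation PSU := (posterior PS PUS).
Local Notation Z_out := (output p (chanZ PSU xf W)).

Lemma Q0E z : Z_out z = Q0 PS W x0 z.
Proof. by rewrite -P_Z_Q0 P_ZE. Qed.

(** Inherited from the ideal output law at the warden, with which [Q0] coincides by [P_Z_Q0]. *)
Lemma Q0_pmf : pmf (Q0 PS W x0).
Proof.
have [out0 out1] := output_pmf (output_pmf PS_pmf PUS_pmf)
  (chanZ_pmf xf (posterior_pmf PS_pmf PUS_pmf) W_pmf).
split=> [z|]; first by rewrite -Q0E.
by rewrite -out1; apply: eq_bigr => z _; rewrite Q0E.
Qed.

Lemma jointE n nM nK (code : nc_code X S Y n nM nK) m k s x y z :
  joint PS W code m k s x y z =
  law (lawprod W) (fun s => \prod_i PS (s i)) (enc code) m k s x y z.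
Proof. by rewrite /joint !INRE. Qed.

(** [KL_bounds] with the product law as reference: [- ln] of it grows at most linearly in [n], which
    is the loss the exponential gap must beat. *)
Lemma KL_warden n nM nK (code : nc_code X S Y n nM nK) :
  (0 < nM)%nat -> (0 < nK)%nat ->
  0 <= KL (warden_dist PS W code) (Q0n PS W x0 (n := n)) <=
  (1 + n%:R * \sum_z - ln (Q0 PS W x0 z)) / ln2 *
  \sum_z `|warden_dist PS W code z - \prod_i Z_out (z i)|.
Proof.
move=> nM0 nK0.
have [Q0_ge0 Q0_sum] := Q0_pmf.
have Q0_le1 z : Q0 PS W x0 z <= 1 by rewrite -Q0_sum (bigD1 z) //= lerDl sumr_ge0.
have enc_pmfs m k s : pmf (enc code m k s) by apply/is_pmfP/enc_pmf.
have warden_pmf : pmf (warden_dist PS W code).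
  have := @law_warden_pmf _ _ _ _ _ (lawprod W) (fun s x => lawprod_pmf s x W_pmf)
    nM nK nM0 nK0 (fun s => \prod_i PS (s i)) (enc code) (iid_pmf _ PS_pmf) enc_pmfs.
  have wE z : warden_dist PS W code z = \sum_m \sum_k \sum_s \sum_x \sum_y
    law (lawprod W) (fun s => \prod_i PS (s i)) (enc code) m k s x y z.
    by do 5![apply: eq_bigr => ? _]; apply: jointE.
  by case=> w0 w1; split=> [z|]; [rewrite wE|rewrite -[RHS]w1; apply: eq_bigr => z _].
have Q0nE (z : {ffun 'I_n -> Z}) : \prod_i Z_out (z i) = Q0n PS W x0 z.
  by apply: eq_bigr => i _; rewrite Q0E.
rewrite (eq_bigr (fun z => `|warden_dist PS W code z - Q0n PS W x0 z|)) => [|z _];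
  last by rewrite Q0nE.
apply: KL_bounds => //.
- exact: (iid_pmf 'I_n Q0_pmf).
- by move=> z; apply: prodr_gt0 => i _.
- rewrite mulr_ge0 // sumr_ge0 // => z _; rewrite -lnV // -expR_ge1 expR_ln ?invr_gt0 //.
  by rewrite invf_ge1.
- by move=> z; apply: ln_prod_lower.
Qed.

Lemma achievable_rate (RM RK RL B : R) : 0 <= RM -> 0 <= RK -> 0 <= RL ->
  information p PSU < RL * ln2 ->
  information p (chanZ PSU xf W) < (RM + RK + RL) * ln2 ->
  RM = 0 \/ (RM + RL) * ln2 < information p (chanY PSU xf W) ->
  E_bX PS W b PUS xf <= B ->
  nc_achievable PS W x0 b RK B RM.
Proof.
move=> RM0 RK0 RL0 rS rZ rY costB; split; first exact/RleP.
have [g [c [g0 g1 c0 codes]]] := exponential_codes (output_pmf PS_pmf PUS_pmf)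
  (posterior_pmf PS_pmf PUS_pmf) W_pmf (output_posterior PS_pmf PUS_pmf) b0
  RM0 RK0 RL0 rS rZ rY.
have code_ex n : exists code : nc_code X S Y n (set_size n RM) (set_size n RK),
  [/\ err_prob PS W code <= c * g ^+ n, exp_cost PS W b code <= B + c * g ^+ n
    & \sum_z `|warden_dist PS W code z - \prod_i Z_out (z i)| <= c * g ^+ n].
  have [e [d [e_pmf err cost warden]]] := codes n.
  have is_e m k s : is_pmf (e m k s).
    by have [e0 e1] := e_pmf m k s; split=> // x; apply/RleP.
  exists (NCCode d is_e); split.
  - apply: le_trans err; rewrite le_eqVlt; apply/orP; left; apply/eqP.
    do 6![apply: eq_bigr => ? _]; by rewrite jointE.
  - apply: le_trans (_ : E_bX PS W b PUS xf + c * g ^+ n <= _); last by rewrite lerD2r.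
    rewrite E_bXE //; apply: le_trans cost; rewrite le_eqVlt; apply/orP; left; apply/eqP.
    do 6![apply: eq_bigr => ? _]; by rewrite jointE /avg_cost INRE.
  - apply: le_trans warden; rewrite le_eqVlt; apply/orP; left; apply/eqP.
    apply: eq_bigr => z _; congr `|_ - _|.
    by do 5![apply: eq_bigr => ? _]; apply: jointE.
(* Choice of one code for every block length. *)
pose code n := sval (boolp.cid (code_ex n)).
have codeP n : [/\ err_prob PS W (code n) <= c * g ^+ n,
    exp_cost PS W b (code n) <= B + c * g ^+ n
  & \sum_z `|warden_dist PS W (code n) z - \prod_i Z_out (z i)| <= c * g ^+ n].
  by rewrite /code; case: boolp.cid.
have [L LE] : exists L, L = \sum_z - ln (Q0 PS W x0 z) by exists (\sum_z - ln (Q0 PS W x0 z)).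
exists code; split; [|split].
- move=> eps eps0; have [N HN] := linear_exponential_cv0 c 0 g0 g1 eps0.
  exists N => n /ssrnat.leP/HN; rewrite mul0r addr0 /R_dist /Rdist Rminus_0_r RabsE => /RltP cg.
  have [_ cost _] := codeP n; apply/RleP; apply: le_trans cost _; rewrite RplusE lerD2l.
  exact: le_trans (ler_norm _) (ltW cg).
- apply: (squeeze_cv0 _ (linear_exponential_cv0 c 0 g0 g1)) => n.
  have [err _ _] := codeP n; rewrite mul0r addr0 err andbT.
  do 6![apply: sumr_ge0 => ? _]; case: ifP => // _; rewrite jointE; apply: law_ge0.
  + by move=> s' x'; apply: lawprod_pmf.
  + by move=> s'; apply: prodr_ge0 => i _; have [] := PS_pmf.
  + by move=> m' k' s'; apply/is_pmfP/enc_pmf.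
- apply: (squeeze_cv0 _ (linear_exponential_cv0 (c / ln2) (L * c / ln2) g0 g1)) => n.
  have [_ _ warden] := codeP n.
  have /andP[-> KL_le] := KL_warden (code n) (set_size_gt0 n RM) (set_size_gt0 n RK).
  apply: le_trans KL_le _; rewrite -LE.
  have -> : (c / ln2 + L * c / ln2 * n%:R) * g ^+ n = (1 + n%:R * L) / ln2 * (c * g ^+ n).
    by ring.
  apply: ler_wpM2l warden; rewrite divr_ge0 ?(ltW ln2_gt0) // addr_ge0 // mulr_ge0 //.
  rewrite LE sumr_ge0 // => z _; have [Q0_ge0 Q0_sum] := Q0_pmf.
  rewrite -lnV // -expR_ge1 expR_ln ?invr_gt0 // invf_ge1 //.
  by rewrite -Q0_sum (bigD1 z) //= lerDl sumr_ge0.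
Qed.

(** The rate of [l] is taken just below [I(U;Y)] minus the message rate: it then exceeds [I(U;S)] by
    the gap condition, and the total rate exceeds [I(U;Z)] by the key condition. *)
Lemma achievable_above (RK B r : R) : 0 <= RK -> E_bX PS W b PUS xf <= B ->
  I_UZ PS W PUS xf - I_UY PS W PUS xf < RK ->
  r < I_UY PS W PUS xf - I_US PS W PUS xf ->
  exists Rt, nc_achievable PS W x0 b RK B Rt /\ r < Rt.
Proof.
have pU_pmf := output_pmf PS_pmf PUS_pmf; have PSU_pmf := posterior_pmf PS_pmf PUS_pmf.
have Y_pmf := chanY_pmf xf PSU_pmf W_pmf; have Z_pmf := chanZ_pmf xf PSU_pmf W_pmf.
have -> : I_UZ PS W PUS xf = information p (chanZ PSU xf W) / ln2.
  by apply: MI_information => // u z; apply: P_UZE.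
have -> : I_UY PS W PUS xf = information p (chanY PSU xf W) / ln2.
  by apply: MI_information => // u y; apply: P_UYE.
have -> : I_US PS W PUS xf = information p PSU / ln2.
  by apply: MI_information => // u s; apply: P_USE.
have iS0 := information_ge0 pU_pmf PSU_pmf; have iZ0 := information_ge0 pU_pmf Z_pmf.
have rate := achievable_rate.
set iS := information p PSU in iS0 rate *; set iZ := information p (chanZ PSU xf W) in iZ0 rate *.
set iY := information p (chanY PSU xf W) in rate *.
have l2 := ln2_gt0.
have scale (x i : R) : i / ln2 < x -> i < x * ln2 by rewrite ltr_pdivrMr.
have scale' (x i : R) : x < i / ln2 -> x * ln2 < i by rewrite ltr_pdivlMr.
have jS0 : 0 <= iS / ln2 by rewrite divr_ge0 // ltW.
have jZ0 : 0 <= iZ / ln2 by rewrite divr_ge0 // ltW.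
move=> RK0 costB key gap.
have [r0|r0] := ltP r 0.
  exists 0; split=> //.
  (* With a single message the rate of [l] can exceed both covering thresholds at once. *)
  apply: (rate 0 RK (iS / ln2 + iZ / ln2 + 1)) => //; last by left.
  - by rewrite !addr_ge0.
  - by apply: scale; lra.
  - by apply: scale; lra.
(* [d] is a quarter of the smaller of the two slacks. *)
have [d [d0 d1 d2]] : exists d, [/\ 0 < d, d * 4 <= iY / ln2 - iS / ln2 - r
    & d * 4 <= RK + iY / ln2 - iZ / ln2].
  set g1 := _ - r; set g2 := _ - _.
  have g10 : 0 < g1 by rewrite /g1; lra.
  have g20 : 0 < g2 by rewrite /g2; lra.
  by have [g12|g21] := leP g1 g2; [exists (g1 / 4)|exists (g2 / 4)]; split; lra.
exists (r + d); split; last by rewrite ltrDl.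
(* The rates of [m] and [l] add up to [I(U;Y) - d], and that of [l] exceeds [I(U;S)] by at least
   [2 d]. *)
apply: (rate (r + d) RK (iY / ln2 - r - 2 * d)) => //.
- lra.
- lra.
- by apply: scale; lra.
- by apply: scale; lra.
- by right; apply: scale'; lra.
Qed.

End Achievability.

Open Scope R_scope.

Theorem theorem4 (X S Y Z : finType) (PS : S -> R) (W : S -> X -> Y -> Z -> R)
  (x0 : X) (b : X -> R)
  (hPS : is_pmf PS)
  (hW : forall s x, is_pmf (fun yz : Y * Z => W s x yz.1 yz.2))
  (hsupp : forall z, 0 < Q0 PS W x0 z)
  (hb : forall x, 0 <= b x)
  (RK B : R) (hRK : 0 <= RK) (hB : 0 <= B) :
  forall (U : finType) (PUS : S -> U -> R) (xf : U -> S -> X),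
    (#|U| <= minn (#|X| + #|Y| + #|Z| + #|S| - 2) (#|X| * #|S| + 1))%nat ->
    (forall s, is_pmf (PUS s)) ->
    (forall z, P_Z PS W PUS xf z = Q0 PS W x0 z) ->
    E_bX PS W b PUS xf <= B ->
    I_UZ PS W PUS xf - I_UY PS W PUS xf < RK ->
    (* C_nc >= I(U;Y) - I(U;S): the supremum of achievable rates is at least
       this value *)
    forall r, r < I_UY PS W PUS xf - I_US PS W PUS xf ->
      exists Rt, nc_achievable PS W x0 b RK B Rt /\ r < Rt.
Proof.
move=> U PUS xf _ hPUS hPZ /RleP hcost /RltP hkey r /RltP hr.
have [|||Rt [ach /RltP r_lt]] := achievable_above (is_pmfP hPS)
  (fun s => is_pmfP (hPUS s)) (fun s x => is_pmfP (hW s x)) _ _ hPZ _ hcost hkey hr.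
- by move=> z; apply/RltP.
- by move=> x; apply/RleP.
- exact/RleP.
by exists Rt.
Qed.
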